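(* Let $S$ be a compact minimal surface in $S^5$ with constant holomorphic angle $\alpha$, whose second fundamental form in the direction $e_3$ is diagonal in the adapted frame, $\theta_1^3=a\,\theta^1$, with constant principal curvature $a$ in the direction $e_3$. Suppose that $S$ has non-negative Gaussian curvature, $K\geq 0$. Then the contact angle $\beta$ of $S$ is constant.
   Context: In $\mathbb{C}^3$ let $(z,w)=\sum_{j=0}^2 z^j\bar w^j$ be the Hermitian product, $\langle z,w\rangle=\operatorname{Re}(z,w)$ the inner product, and $S^5=\{z\in\mathbb{C}^3 : (z,z)=1\}$ with the induced metric. The Reeb vector field on $S^5$ is $\xi(z)=iz$, and the contact distribution is $D_z=\{v\in T_zS^5 : \langle \xi,v\rangle=0\}$, which is invariant under multiplication by $i$. Let $S$ be an orientable surface immersed in $S^5$. Choose a local orthonormal frame $(e_1,e_2)$ of $TS$ with $e_1\in TS\cap D$. The contact angle $\beta$ is the complementary angle between the contact distribution $D$ and the tangent space $TS$; it satisfies $\cos\beta=\langle\xi,e_2\rangle$. Let $v$ be the unit vector in the direction of the orthogonal projection of $e_2$ on $D$, so that $e_2=\sin\beta\, v+\cos\beta\,\xi$. The holomorphic angle $\alpha$ is defined by $\cos\alpha=\langle ie_1,v\rangle$. It is assumed throughout that $\alpha,\beta\neq 0,\pi$. The adapted frame $(e_j)_{1\le j\le 5}$ is completed by the normal fields $$e_3=i\csc\alpha\, e_1-\cot\alpha\, v,\qquad e_4=\cot\alpha\, e_1+i\csc\alpha\, v,\qquad e_5=\csc\beta\,\xi-\cot\beta\, e_2 .$$ Let $(\theta^j)$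 be the dual coframe and $(\theta_j^k)$ the connection forms, $De_j=\theta_j^k e_k$. On $S$ write $\theta_1^3=a\,\theta^1+b\,\theta^2$. The surfaces considered are those for which the second fundamental form in the direction $e_3$ is diagonal in this frame, i.e. $b=0$ and $\theta_1^3=a\,\theta^1$; the function $a$ is the principal curvature in the direction $e_3$. *)

(* Defs.v *)
From mathcomp Require Import all_boot all_order all_algebra.
From mathcomp Require Import all_classical all_reals all_analysis.
From mathcomp Require Import complex.

Set Implicit Arguments.
Unset Strict Implicit.
Unset Printing Implicit Defensive.

Import Order.TTheory GRing.Theory Num.Theory.
Import numFieldNormedType.Exports.

Local Open Scope classical_set_scope.
Local Open Scope ring_scope.
Local Open Scope complex_scope.

Notation "''C3[' R ]" := 'rV[R[i]]_3 (at level 0, format "''C3[' R ]").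

Definition herm (R : realType) (z w : 'C3[R]) : R[i] :=
  \sum_(j < 3) z 0 j * conjc (w 0 j).

Definition inner (R : realType) (z w : 'C3[R]) : R := complex.Re (herm z w).

Definition scale (R : realType) (r : R) (z : 'C3[R]) : 'C3[R] := r%:C *: z.

Definition mulI (R : realType) (z : 'C3[R]) : 'C3[R] := (0 +i* 1) *: z.

Definition S5 (R : realType) : set 'C3[R] := [set z | herm z z = 1].

Definition tangentS5 (R : realType) (z : 'C3[R]) : set 'C3[R] :=
  [set v | inner z v = 0].

Definition reeb (R : realType) (z : 'C3[R]) : 'C3[R] := mulI z.

Definition contactD (R : realType) (z : 'C3[R]) : set 'C3[R] :=
  [set v | tangentS5 z v /\ inner (reeb z) v = 0].

(** Orthogonal projection of [T_z S^5] onto [D_z]; the argument [w] is meant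
    to be tangent to [S^5] at [z]. *)
Definition projD (R : realType) (z w : 'C3[R]) : 'C3[R] :=
  w - scale (inner (reeb z) w) (reeb z).

Definition unit_dir (R : realType) (w : 'C3[R]) : 'C3[R] :=
  scale (Num.sqrt (inner w w))^-1 w.

Definition pd (R : realType) (k : 'I_2) (f : 'rV[R]_2 -> R) : 'rV[R]_2 -> R :=
  fun u => 'D_('e_k) f u.

(** C^infinity: every iterated partial derivative is differentiable on [U]
    (hence continuous there). *)
Definition smooth (R : realType) (U : set 'rV[R]_2) (f : 'rV[R]_2 -> R) :=
  forall (s : seq 'I_2) (u : 'rV[R]_2), U u ->
    differentiable (foldr (@pd R) f s) u.

Definition smooth2 (R : realType) (U : set 'rV[R]_2)
    (f : 'rV[R]_2 -> 'rV[R]_2) :=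
  forall j : 'I_2, smooth U (fun u => f u 0 j).

Definition jac (R : realType) (f : 'rV[R]_2 -> 'rV[R]_2) (u : 'rV[R]_2) :
  'M[R]_2 := \matrix_(k, j) pd k (fun w => f w 0 j) u.

Definition smoothC3 (R : realType) (U : set 'rV[R]_2) (Y : 'rV[R]_2 -> 'C3[R]) :=
  forall j : 'I_3, smooth U (fun u => complex.Re (Y u 0 j)) /\
                   smooth U (fun u => complex.Im (Y u 0 j)).

Definition pdC3 (R : realType) (k : 'I_2) (Y : 'rV[R]_2 -> 'C3[R]) :
    'rV[R]_2 -> 'C3[R] :=
  fun u => \row_j (pd k (fun w => complex.Re (Y w 0 j)) u +i*
                   pd k (fun w => complex.Im (Y w 0 j)) u).

(** A local parametrization; only the restriction of [par] to [dom] matters. *)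
Record param (R : realType) (M : topologicalType) := Param {
  dom : set 'rV[R]_2;
  par :> 'rV[R]_2 -> M
}.

Definition is_param (R : realType) (M : topologicalType) (phi : param R M) :=
  [/\ open (dom phi),
      {in dom phi &, injective phi},
      forall u, dom phi u -> {for u, continuous phi} &
      forall V : set 'rV[R]_2, open V -> V `<=` dom phi -> open (phi @` V)].

(** Parametrizations covering [M] whose transition maps [psi^-1 \o phi] are
    smooth with positive Jacobian; the transition map is given by a local
    representative [tau] near each point of the overlap. *)
Definition oriented_atlas (R : realType) (M : topologicalType)
    (A : set (param R M)) :=
  [/\ forall phi, A phi -> is_param phi,
      forall p : M, exists phi u, [/\ A phi, dom phi u & phi u = p] &
      forall phi psi, A phi -> A psi ->
      forall u v, dom phi u -> dom psi v -> phi u = psi v ->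
      exists (W : set 'rV[R]_2) (tau : 'rV[R]_2 -> 'rV[R]_2),
        [/\ open W, W u & W `<=` dom phi] /\
        [/\ smooth2 W tau,
            forall w, W w -> dom psi (tau w) /\ psi (tau w) = phi w &
            0 < \det (jac tau u)]].

Definition compact_surface (R : realType) (M : topologicalType)
    (A : set (param R M)) :=
  [/\ hausdorff_space M, connected [set: M], compact [set: M] &
      oriented_atlas A].

Definition immersion (R : realType) (M : topologicalType)
    (A : set (param R M)) (F : M -> 'C3[R]) :=
  forall phi, A phi ->
    smoothC3 (dom phi) (F \o phi) /\
    forall u, dom phi u -> forall c : 'I_2 -> R,
      \sum_k scale (c k) (pdC3 k (F \o phi) u) = 0 -> forall k, c k = 0.

Definition tangent (R : realType) (X : 'rV[R]_2 -> 'C3[R]) (u : 'rV[R]_2) :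
    set 'C3[R] :=
  [set v | exists c : 'I_2 -> R, v = \sum_k scale (c k) (pdC3 k X u)].

Definition metric (R : realType) (X : 'rV[R]_2 -> 'C3[R]) (u : 'rV[R]_2) :
    'M[R]_2 :=
  \matrix_(i, j) inner (pdC3 i X u) (pdC3 j X u).

(** The Levi-Civita connection [D] of [S^5] along [X]: the derivative in C^3,
    projected orthogonally to the position vector. *)
Definition covD (R : realType) (X : 'rV[R]_2 -> 'C3[R]) (k : 'I_2)
    (Y : 'rV[R]_2 -> 'C3[R]) (u : 'rV[R]_2) : 'C3[R] :=
  pdC3 k Y u - scale (inner (pdC3 k Y u) (X u)) (X u).

Definition normal_part (R : realType) (X : 'rV[R]_2 -> 'C3[R]) (u : 'rV[R]_2)
    (w : 'C3[R]) : 'C3[R] :=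
  w - \sum_k \sum_l
    scale (invmx (metric X u) k l * inner w (pdC3 k X u)) (pdC3 l X u).

Definition second_form (R : realType) (X : 'rV[R]_2 -> 'C3[R]) (i j : 'I_2)
    (u : 'rV[R]_2) : 'C3[R] :=
  normal_part X u (covD X i (pdC3 j X) u).

Definition mean_curvature (R : realType) (X : 'rV[R]_2 -> 'C3[R])
    (u : 'rV[R]_2) : 'C3[R] :=
  scale 2^-1
    (\sum_i \sum_j scale (invmx (metric X u) i j) (second_form X i j u)).

(** [christoffel X k i j] is the symbol [Gamma^k_(ij)] of the induced metric. *)
Definition christoffel (R : realType) (X : 'rV[R]_2 -> 'C3[R]) (k i j : 'I_2)
    (u : 'rV[R]_2) : R :=
  2^-1 * \sum_l invmx (metric X u) k l *
    (pd i (fun w => metric X w j l) u + pd j (fun w => metric X w i l) u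
     - pd l (fun w => metric X w i j) u).

(** Coefficient of [d_l] in [R(d_i, d_j) d_k], where
    [R(U, V) = [nabla_U, nabla_V] - nabla_[U, V]]. *)
Definition riemann (R : realType) (X : 'rV[R]_2 -> 'C3[R]) (l k i j : 'I_2)
    (u : 'rV[R]_2) : R :=
  pd i (christoffel X l j k) u - pd j (christoffel X l i k) u
  + \sum_m (christoffel X l i m u * christoffel X m j k u
            - christoffel X l j m u * christoffel X m i k u).

(** [<R(d_0, d_1) d_1, d_0> / det g], which is [1] on the unit sphere. *)
Definition gauss_curvature (R : realType) (X : 'rV[R]_2 -> 'C3[R])
    (u : 'rV[R]_2) : R :=
  (\sum_l riemann X l 1 0 1 u * metric X u l 0) / \det (metric X u).

(** Smooth orthonormal frames [(e1, e2)] of the surface over [W] with [e1]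
    in the contact distribution. *)
Definition adapted_frame (R : realType) (X : 'rV[R]_2 -> 'C3[R])
    (W : set 'rV[R]_2) (e1 e2 : 'rV[R]_2 -> 'C3[R]) :=
  [/\ smoothC3 W e1, smoothC3 W e2 &
      forall w, W w ->
        [/\ tangent X w (e1 w), tangent X w (e2 w) & contactD (X w) (e1 w)] /\
        [/\ inner (e1 w) (e1 w) = 1, inner (e2 w) (e2 w) = 1 &
            inner (e1 w) (e2 w) = 0]].

Definition contact_angle (R : realType) (z e2 : 'C3[R]) : R :=
  acos (inner (reeb z) e2).

Definition vvec (R : realType) (z e2 : 'C3[R]) : 'C3[R] :=
  unit_dir (projD z e2).

Definition holomorphic_angle (R : realType) (z e1 e2 : 'C3[R]) : R :=
  acos (inner (mulI e1) (vvec z e2)).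

Definition csc (R : realType) (x : R) : R := (sin x)^-1.
Definition cot (R : realType) (x : R) : R := cos x / sin x.

Definition e3vec (R : realType) (z e1 e2 : 'C3[R]) : 'C3[R] :=
  let alpha := holomorphic_angle z e1 e2 in
  scale (csc alpha) (mulI e1) - scale (cot alpha) (vvec z e2).

(** The dual coframe and connection forms are evaluated on the coordinate
    field [d_k]: [coframe X e] is [theta^1] for [e = e1], [theta^2] for
    [e = e2]. *)
Definition coframe (R : realType) (X e : 'rV[R]_2 -> 'C3[R]) (k : 'I_2)
    (u : 'rV[R]_2) : R :=
  inner (pdC3 k X u) (e u).

Definition theta13 (R : realType) (X e1 e2 : 'rV[R]_2 -> 'C3[R]) (k : 'I_2)
    (u : 'rV[R]_2) : R :=
  inner (covD X k e1 u) (e3vec (X u) (e1 u) (e2 u)).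

(** [beta], [alpha], [a], [b] are the contact angle, the holomorphic angle and
    the coefficients of [theta_1^3 = a theta^1 + b theta^2], computed in some
    local adapted frame around every point. An adapted frame is not determined
    by the surface ([e1] and [e2] may each be replaced by their opposite), so
    one and the same local frame has to realize all four functions. *)
Definition adapted_data (R : realType) (M : topologicalType)
    (A : set (param R M)) (F : M -> 'C3[R]) (beta alpha a b : M -> R) :=
  forall p : M, exists (phi : param R M) (u : 'rV[R]_2) (W : set 'rV[R]_2)
      (e1 e2 : 'rV[R]_2 -> 'C3[R]),
    let X := F \o phi in
    [/\ A phi, dom phi u & phi u = p] /\
    [/\ open W, W u & W `<=` dom phi] /\
    adapted_frame X W e1 e2 /\
    forall w, W w ->
      [/\ beta (phi w) = contact_angle (X w) (e2 w),
          alpha (phi w) = holomorphic_angle (X w) (e1 w) (e2 w) &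
          forall k, theta13 X e1 e2 k w = a (phi w) * coframe X e1 k w
                                        + b (phi w) * coframe X e2 k w].

Definition is_constant (R : realType) (T : Type) (f : T -> R) :=
  exists c : R, forall x, f x = c.

(* Main.v *)
Require Import Defs.
From HB Require Import structures.
From mathcomp Require Import all_boot all_order all_algebra.
From mathcomp Require Import all_classical all_reals all_analysis.
From mathcomp Require Import complex ring lra.

Set Implicit Arguments.
Unset Strict Implicit.
Unset Printing Implicit Defensive.

Import Order.TTheory GRing.Theory Num.Theory.
Import numFieldNormedType.Exports.

Local Open Scope classical_set_scope.
Local Open Scope ring_scope.

(** Let [c] and [s] be the cosine and sine of the contact angle [beta], [k] and [sg]
    those of the constant holomorphic angle, and [a] the principal curvature. The
    position [X], the contact vector [e1] and a third unit vector [n] form a unitary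
    frame of C^3 along the surface, in which
      [e2 = c (i X) + s k (i e1) + s sg n].
    Differentiating it and using minimality and [theta_1^3 = a theta^1], all
    connection forms of the unitary frame are expressed by the connection form
    [omega = theta_1^2] of the surface ([first_order]). One finds
      [d c (e1) = 2 s k - c omega(e2)] and [d c (e2) = c omega(e1)],
    and two Codazzi equations turn out to contain no derivative at all
    ([codazzi_e3], [codazzi_in]):
      [a omega(e2) = 0],
      [a omega(e1) (2 + s^2) / s = 2 sg omega(e2) c / s - sg k / s^2
                                   - a^2 k c^2 / (sg s^2)].
    They leave three cases, each settled at the extrema of [c^2] on the compact
    surface.

    If [a] is not [0], then [omega(e2) = 0] and [d c (e1) = 2 s k] vanishes at a
    maximum of [c^2]; so [k = 0], then [omega = 0] and [d c = 0].

    If [a = 0] and [k] is not [0], then [2 omega(e2) c s = k] and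
    [d c (e1) = k (4 s^2 - 1) / (2 s)], so that [c^2 = 3 / 4] both at the maxima and at
    the minima of [c^2].

    If [a = k = 0], then [d c (e1) = 0], and where [c] is not [0] the remaining Codazzi
    equation is an ordinary differential equation for [omega(e1)] with the first
    integral [(1 + omega(e1)^2) / (s c)^2] ([first_integral]). At a maximum of [c^2] the
    Gauss equation gives [K = 1 - c^2 / s^2], so the hypothesis [K >= 0] yields
    [c^2 <= 1 / 2], and the first integral forces [c^2] to be constant near the
    maximum ([ccos_near_max]). By connectedness [c^2] is constant.

    In all cases [c] is constant as it is continuous on a connected surface. *)

(** * Calculus in the plane *)

Section calculus.
Variable R : realType.
Implicit Types (f g : 'rV[R]_2 -> R) (u p : 'rV[R]_2) (k i j : 'I_2).

Lemma is_derive_line f p k (t : R) :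
  differentiable f (p + t *: 'e_k) ->
  is_derive t 1 (fun r : R => f (p + r *: 'e_k)) (pd k f (p + t *: 'e_k)).
Proof.
move=> df; have := @diff_derivable _ _ _ _ _ 'e_k df.
have E : (fun h : R => h^-1 *: ((f \o shift (p + t *: 'e_k)) (h *: 'e_k)
                         - f (p + t *: 'e_k)))
     = (fun h : R => h^-1 *: (((fun r => f (p + r *: 'e_k)) \o shift t)
                         (h *: 1) - f (p + t *: 'e_k))).
  apply/funext => h; congr (_ *: (f _ - _)).
  by rewrite /= [h *: 1]mulr1 scalerDl addrCA.
rewrite /derivable E => dg.
by apply: DeriveDef; rewrite // /pd /derive E.
Qed.

Lemma norm_basis_le1 k : `|'e_k : 'rV[R]_2| <= 1.
Proof.
rewrite {1}/Num.Def.normr /= mx_normrE; apply: bigmax_le => // -[a b] _ /=.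
by rewrite !mxE; case: (_ && _); rewrite ?normr1 ?normr0.
Qed.

Lemma mvt_line f p k (h : R) : 0 < h ->
  (forall t, 0 <= t <= h -> differentiable f (p + t *: 'e_k)) ->
  exists2 t, 0 < t < h &
    f (p + h *: 'e_k) - f p = pd k f (p + t *: 'e_k) * h.
Proof.
move=> h0 df.
have dg t : 0 <= t <= h ->
    is_derive t 1 (fun r : R => f (p + r *: 'e_k)) (pd k f (p + t *: 'e_k)).
  by move=> /df; exact: is_derive_line.
have [||t] := @MVT R (fun r => f (p + r *: 'e_k))
                 (fun t => pd k f (p + t *: 'e_k)) 0 h h0.
- by move=> x; rewrite in_itv /= => /andP[x0 xh]; apply: dg; rewrite !ltW.
- apply: derivable_within_continuous => x; rewrite in_itv /= => /dg xx.
  exact: ex_derive.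
- rewrite in_itv /= => th; rewrite scale0r addr0 subr0 => ->.
  by exists t.
Qed.

Lemma smooth_pd (U : set 'rV[R]_2) f k : smooth U f -> smooth U (pd k f).
Proof. by move=> sf s u Uu; have := sf (rcons s k) u Uu; rewrite foldr_rcons. Qed.

Lemma smooth_diff (U : set 'rV[R]_2) f u : smooth U f -> U u -> differentiable f u.
Proof. by move=> sf /(sf [::]). Qed.

Lemma near_eq_pd f g k u : (\forall w \near u, f w = g w) -> pd k f u = pd k g u.
Proof. by move=> fg; rewrite /pd; apply: near_eq_derive. Qed.

Lemma pdB f g k u : differentiable f u -> differentiable g u ->
  pd k (fun w => f w - g w) u = pd k f u - pd k g u.
Proof.
move=> df dg.
exact: deriveB (@diff_derivable _ _ _ _ _ _ df) (@diff_derivable _ _ _ _ _ _ dg).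
Qed.

Lemma pd_shift f k (c u : 'rV[R]_2) : pd k (fun w => f (w + c)) u = pd k f (u + c).
Proof.
rewrite /pd /derive; set A := fun h : R => _; set B := fun h : R => _.
by have -> : A = B by apply/funext => s; rewrite /A /B /= addrA.
Qed.

Local Opaque pd.

(** Symmetry of second derivatives, by applying the mean value theorem twice
    to the same second difference. *)
Lemma schwarz (U : set 'rV[R]_2) f u i j : open U -> U u -> smooth U f ->
  pd i (pd j f) u = pd j (pd i f) u.
Proof.
move=> oU Uu sf.
wlog: i j / pd i (pd j f) u < pd j (pd i f) u.
  move=> H; have [/H //|/H -> //|//] := ltrgtP (pd i (pd j f) u) (pd j (pd i f) u).
move=> AB.
have [m Am mB] : exists2 m, pd i (pd j f) u < m & m < pd j (pd i f) u.
  by exists ((pd i (pd j f) u + pd j (pd i f) u) / 2); rewrite (midf_lt AB).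
have cA : {for u, continuous (pd i (pd j f))}.
  by apply: differentiable_continuous; apply: (smooth_diff _ Uu); do 2! apply: smooth_pd.
have cB : {for u, continuous (pd j (pd i f))}.
  by apply: differentiable_continuous; apply: (smooth_diff _ Uu); do 2! apply: smooth_pd.
have nA : \forall w \near u, pd i (pd j f) w < m.
  exact: cvgr_lt cA _ Am.
have nB : \forall w \near u, m < pd j (pd i f) w.
  exact: cvgr_gt cB _ mB.
have nU : \forall w \near u, U w by exact: open_nbhs_nbhs.
have : \forall w \near u, [/\ U w, pd i (pd j f) w < m & m < pd j (pd i f) w].
  by near=> w; split; near: w.
move=> /nbhs_ballP[e /= e0 He].
have [h h0 h3] : exists2 h, 0 < h & 3 * h = e.
  by exists (e / 3); [rewrite divr_gt0 | field].
have hE t r : 0 <= t <= h -> 0 <= r <= h -> forall k l,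
  [/\ U (u + t *: 'e_k + r *: 'e_l), pd i (pd j f) (u + t *: 'e_k + r *: 'e_l) < m
   & m < pd j (pd i f) (u + t *: 'e_k + r *: 'e_l)].
  move=> /andP[t0 th] /andP[r0 rh] k l; apply: He.
  rewrite -ball_normE /= -addrA opprD addrA subrr sub0r normrN.
  apply: le_lt_trans (ler_normD _ _) _; rewrite !normrZ !ger0_norm //.
  have := norm_basis_le1 k; have := norm_basis_le1 l.
  move: (normr_ge0 ('e_k : 'rV[R]_2)) (normr_ge0 ('e_l : 'rV[R]_2)).
  set a := `|_|; set b := `|_| => a0 b0 b1 a1.
  have ta : t * a <= h * 1 by apply: ler_pM.
  have rb : r * b <= h * 1 by apply: ler_pM.
  by clear -ta rb h0 h3; lra.
have hE0 t : 0 <= t <= h -> forall k, U (u + t *: 'e_k).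
  move=> tt k; have h00 : 0 <= (0 : R) <= h by rewrite lexx ltW.
  by have [] := hE _ _ tt h00 k k; rewrite scale0r addr0.
have hh : 0 <= h <= h by rewrite lexx ltW.
have sub k l : exists t r, [/\ 0 <= t <= h, 0 <= r <= h &
   f (u + h *: 'e_l + h *: 'e_k) - f (u + h *: 'e_k) - (f (u + h *: 'e_l) - f u)
   = pd l (pd k f) (u + t *: 'e_k + r *: 'e_l) * h * h].
  pose g := fun w => f (w + h *: 'e_l) - f w.
  have dsh w : differentiable f (w + h *: 'e_l) ->
      differentiable (fun w => f (w + h *: 'e_l)) w.
    move=> df; have dw : differentiable (fun x => x + h *: 'e_l : 'rV[R]_2) w.
      exact: (@differentiableD _ _ _ id (cst (h *: 'e_l)) w).
    exact: (differentiable_comp dw df).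
  have dg t : 0 <= t <= h -> differentiable g (u + t *: 'e_k).
    move=> tt; apply: differentiableB.
      by apply: dsh; apply: (smooth_diff sf); have [] := hE _ _ tt hh k l.
    by apply: (smooth_diff sf); exact: hE0.
  have [t /andP[t0 th] Et] := mvt_line h0 dg.
  have tt : 0 <= t <= h by rewrite !ltW.
  have dpk r : 0 <= r <= h ->
     differentiable (pd k f) ((u + t *: 'e_k) + r *: 'e_l).
    move=> rr; apply: (@smooth_diff U); first exact: smooth_pd.
    by have [] := hE _ _ tt rr k l.
  have [r /andP[r0 rh] Er] := mvt_line h0 dpk.
  exists t, r; split; rewrite ?ltW //.
  have ft : differentiable f (u + t *: 'e_k + h *: 'e_l).
    by apply: (smooth_diff sf); have [] := hE _ _ tt hh k l.
  have f0 : differentiable f (u + t *: 'e_k) by apply: (smooth_diff sf); exact: hE0.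
  have Eg : pd k f (u + t *: 'e_k + h *: 'e_l) - pd k f (u + t *: 'e_k)
       = pd k g (u + t *: 'e_k).
    by rewrite (pdB _ (dsh _ ft) f0) pd_shift.
  rewrite -Er Eg.
  by rewrite -Et /g [u + h *: 'e_k + _]addrAC.
have [t [r [tt rr E1]]] := sub i j.
have [t' [r' [tt' rr' E2]]] := sub j i.
have [_ _ mB'] := hE _ _ tt rr i j.
have [_ mA' _] := hE _ _ tt' rr' j i.
have E : pd j (pd i f) (u + t *: 'e_i + r *: 'e_j) =
       pd i (pd j f) (u + t' *: 'e_j + r' *: 'e_i).
  apply: (mulIf (lt0r_neq0 h0)); apply: (mulIf (lt0r_neq0 h0)).
  apply: etrans (esym E1) (etrans _ E2); rewrite [u + h *: 'e_i + _]addrAC.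
  move: (f (_ + h *: _)) (f (u + h *: 'e_i)) (f (u + h *: 'e_j)) (f u) => x y z v.
  by ring.
move: mB' mA'; rewrite E; move: (pd i _ _) => x mx xm.
by exfalso; have := lt_trans mx xm; rewrite ltxx.
Unshelve. all: by end_near.
Qed.

Lemma constant_on_line f p k (h : R) :
  (forall t, `|t| <= `|h| ->
     differentiable f (p + t *: 'e_k) /\ pd k f (p + t *: 'e_k) = 0) ->
  f (p + h *: 'e_k) = f p.
Proof.
move=> H; have [h0|h0|<-] := ltrgtP 0 h; last by rewrite scale0r addr0.
- have ht t : 0 <= t <= h -> `|t| <= `|h|.
    by move=> /andP[t0 th]; rewrite (gtr0_norm h0) ger0_norm.
  have [t tt|t /andP[t0 th]] := @mvt_line f p k h h0; first by case: (H _ (ht _ tt)).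
  have tt : 0 <= t <= h by rewrite !ltW.
  have [_ ->] := H _ (ht _ tt).
  by rewrite mul0r => /eqP; rewrite subr_eq0 => /eqP.
- have h0' : 0 < - h by rewrite oppr_gt0.
  have ht t : 0 <= t <= - h -> `|h + t| <= `|h|.
    by rewrite (ltr0_norm h0) ler_norml => /andP[? ?]; apply/andP; split; lra.
  have [t tt|t /andP[t0 th]] := @mvt_line f (p + h *: 'e_k) k (- h) h0'.
    by rewrite -addrA -scalerDl; have [] := H _ (ht _ tt).
  have tt : 0 <= t <= - h by rewrite !ltW.
  have [_] := H _ (ht _ tt); rewrite scalerDl addrA => ->.
  rewrite -!addrA -scalerDl subrr scale0r addr0 mul0r.
  by move/eqP; rewrite subr_eq0 => /eqP.
Qed.

(** Axis-parallel paths suffice, balls of the maximum norm being squares. *)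
Lemma near_constant f u :
  (\forall w \near u, differentiable f w /\ forall k, pd k f w = 0) ->
  \forall w \near u, f w = f u.
Proof.
move=> /nbhs_ballP[e /= e0 He]; apply/nbhs_ballP; exists e => //= w uw.
have b (a0 a1 : R) : `|a0| <= `|w 0 0 - u 0 0| -> `|a1| <= `|w 0 1 - u 0 1| ->
    ball u e (u + a0 *: 'e_0 + a1 *: 'e_1).
  move=> h0 h1; split=> // i j; have [_ /(_ i j)] := uw.
  rewrite !ord1 -!ball_normE /= !mxE /=.
  case: (j =P 0) => [->|/eqP j0] /=; first by
    rewrite mulr1 mulr0 addr0 opprD addNKr normrN distrC => /(le_lt_trans h0).
  have -> : j = 1 by case: j j0 => -[|[|//]] //= ? _; exact/val_inj.
  by rewrite mulr1 mulr0 addr0 opprD addNKr normrN distrC => /(le_lt_trans h1).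
have -> : w = u + (w 0 0 - u 0 0) *: 'e_0 + (w 0 1 - u 0 1) *: 'e_1.
  apply/rowP => j; rewrite !mxE /=.
  case: (j =P 0) => [->|/eqP j0] /=; first by rewrite mulr1 mulr0 addr0 subrKC.
  have -> : j = 1 by case: j j0 => -[|[|//]] //= ? _; exact/val_inj.
  by rewrite mulr1 mulr0 addr0 subrKC.
rewrite constant_on_line => [|t tt].
  apply: constant_on_line => t tt.
  have /He[] : ball u e (u + t *: 'e_0).
    by have := b _ 0 tt; rewrite scale0r addr0 normr0; apply.
  by move=> ? H.
by have /He[] : ball u e (u + (w 0 0 - u 0 0) *: 'e_0 + t *: 'e_1) by exact: b.
Qed.

End calculus.

(** * The Hermitian space C^3 *)

(** Sealed copies: unification would otherwise unfold a failing match of vectors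
    down to the arithmetic of complex numbers. *)
HB.lock Definition ip (R : realType) (z w : 'C3[R]) : R := inner z w.
HB.lock Definition sc (R : realType) (r : R) (z : 'C3[R]) : 'C3[R] := scale r z.
HB.lock Definition mI (R : realType) (z : 'C3[R]) : 'C3[R] := mulI z.
Canonical ip_unlockable := Unlockable ip.unlock.
Canonical sc_unlockable := Unlockable sc.unlock.
Canonical mI_unlockable := Unlockable mI.unlock.

Section hermitian.
Variable R : realType.
Implicit Types (z w v f : 'C3[R]) (r : R).
Local Notation Re := complex.Re.
Local Notation Im := complex.Im.

Lemma inner_ip z w : inner z w = ip z w.
Proof. by rewrite unlock. Qed.

Lemma scale_sc r z : scale r z = sc r z.
Proof. by rewrite unlock. Qed.

Lemma mulI_mI z : mulI z = mI z.
Proof. by rewrite unlock. Qed.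

Lemma ipE z w :
  ip z w = \sum_j (Re (z 0 j) * Re (w 0 j) + Im (z 0 j) * Im (w 0 j)).
Proof.
rewrite unlock /inner /herm raddf_sum /=; apply: eq_bigr => j _.
by case: (z 0 j) (w 0 j) => a b [c d] /=; rewrite mulrN opprK.
Qed.

Lemma Re_sc r z j : Re (sc r z 0 j) = r * Re (z 0 j).
Proof. by rewrite unlock !mxE; case: (z 0 j) => a b /=; rewrite mul0r subr0. Qed.

Lemma Im_sc r z j : Im (sc r z 0 j) = r * Im (z 0 j).
Proof. by rewrite unlock !mxE; case: (z 0 j) => a b /=; rewrite mul0r addr0. Qed.

Lemma Re_mI z j : Re (mI z 0 j) = - Im (z 0 j).
Proof. by rewrite unlock !mxE; case: (z 0 j) => a b /=; ring. Qed.

Lemma Im_mI z j : Im (mI z 0 j) = Re (z 0 j).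
Proof. by rewrite unlock !mxE; case: (z 0 j) => a b /=; ring. Qed.

Lemma ReD z w j : Re ((z + w) 0 j) = Re (z 0 j) + Re (w 0 j).
Proof. by rewrite mxE raddfD. Qed.

Lemma ImD z w j : Im ((z + w) 0 j) = Im (z 0 j) + Im (w 0 j).
Proof. by rewrite mxE raddfD. Qed.

Lemma ReN z j : Re ((- z) 0 j) = - Re (z 0 j).
Proof. by rewrite mxE raddfN. Qed.

Lemma ImN z j : Im ((- z) 0 j) = - Im (z 0 j).
Proof. by rewrite mxE raddfN. Qed.

Lemma eqC3 z w :
  (forall j, Re (z 0 j) = Re (w 0 j) /\ Im (z 0 j) = Im (w 0 j)) -> z = w.
Proof.
move=> zw; apply/rowP => j; apply/eqP; rewrite eq_complex.
by have [-> ->] := zw j; rewrite !eqxx.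
Qed.

Lemma ipC z w : ip z w = ip w z.
Proof. by rewrite !ipE; apply: eq_bigr => j _; rewrite mulrC [X in _ + X]mulrC. Qed.

Lemma ipDl z w v : ip (z + w) v = ip z v + ip w v.
Proof.
rewrite !ipE -big_split /=; apply: eq_bigr => j _; rewrite ReD ImD.
by rewrite !mulrDl addrACA.
Qed.

Lemma ipZl r z w : ip (sc r z) w = r * ip z w.
Proof.
rewrite !ipE mulr_sumr; apply: eq_bigr => j _; rewrite Re_sc Im_sc.
by rewrite -!mulrA -mulrDr.
Qed.

Lemma ipNl z w : ip (- z) w = - ip z w.
Proof.
rewrite !ipE -sumrN; apply: eq_bigr => j _; rewrite ReN ImN.
by rewrite !mulNr opprD.
Qed.

Lemma ipDr z w v : ip v (z + w) = ip v z + ip v w.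
Proof. by rewrite ipC ipDl !(ipC v). Qed.

Lemma ipZr r z w : ip w (sc r z) = r * ip w z.
Proof. by rewrite ipC ipZl (ipC w). Qed.

Lemma ipNr z w : ip w (- z) = - ip w z.
Proof. by rewrite ipC ipNl (ipC w). Qed.

Lemma ip0l z : ip 0 z = 0.
Proof. by rewrite -(subrr z) ipDl ipNl subrr. Qed.

Lemma ip_suml (I : finType) (F : I -> 'C3[R]) z :
  ip (\sum_i F i) z = \sum_i ip (F i) z.
Proof.
elim/big_rec2: _ => [|i y x _ E]; first exact: ip0l.
by rewrite ipDl E.
Qed.

Lemma ip_mIl z w : ip (mI z) w = - ip z (mI w).
Proof.
rewrite !ipE -sumrN; apply: eq_bigr => j _; rewrite !Re_mI !Im_mI.
by move: (Re _) (Im _) (Re _) (Im _) => *; ring.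
Qed.

Lemma ip_mI2 z w : ip (mI z) (mI w) = ip z w.
Proof.
rewrite !ipE; apply: eq_bigr => j _; rewrite !Re_mI !Im_mI.
by rewrite mulrNN addrC.
Qed.

Lemma ip_mI z : ip z (mI z) = 0.
Proof. by have := ip_mIl z z; rewrite ipC; move: (ip _ _) => x; lra. Qed.

Lemma mI_mI z : mI (mI z) = - z.
Proof. by apply: eqC3 => j; rewrite Re_mI !Im_mI Re_mI ReN ImN. Qed.

Lemma mID z w : mI (z + w) = mI z + mI w.
Proof. by apply: eqC3 => j; rewrite !(ReD, ImD, Re_mI, Im_mI) opprD. Qed.

Lemma mIN z : mI (- z) = - mI z.
Proof. by apply: eqC3 => j; rewrite !(ReN, ImN, Re_mI, Im_mI). Qed.

Lemma mIZ r z : mI (sc r z) = sc r (mI z).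
Proof. by apply: eqC3 => j; rewrite !(Re_sc, Im_sc, Re_mI, Im_mI) mulrN. Qed.

Lemma ip_gt0 z : z != 0 -> 0 < ip z z.
Proof.
move=> z0; rewrite lt_neqAle eq_sym; apply/andP; split; last first.
  by rewrite ipE sumr_ge0 // => j _; rewrite -!expr2 addr_ge0 ?sqr_ge0.
apply: contraNneq z0 => E; apply/eqP/rowP => j; rewrite mxE.
have /eqP := E; rewrite ipE psumr_eq0 => [|i _]; last by rewrite -!expr2 addr_ge0 ?sqr_ge0.
move=> /allP /(_ j); rewrite mem_index_enum => /(_ isT) /=.
case: (z 0 j) => a b /=; rewrite -!expr2 paddr_eq0 ?sqr_ge0 // !sqrf_eq0.
by move=> /andP[/eqP -> /eqP ->].
Qed.

Lemma cauchy_schwarz z w : ip z z = 1 -> ip w w = 1 -> -1 <= ip z w <= 1.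
Proof.
move=> zz ww.
have ge0 v : 0 <= ip v v by have [->|/ip_gt0/ltW//] := eqVneq v 0; rewrite ip0l.
have := ge0 (z + w); have := ge0 (z - w).
rewrite !(ipDl, ipDr, ipNl, ipNr) (ipC w z) zz ww.
by move: (ip z w) => x h1 h2; apply/andP; split; lra.
Qed.

Lemma scDl r t z : sc (r + t) z = sc r z + sc t z.
Proof. by apply: eqC3 => j; rewrite !(Re_sc, Im_sc, ReD, ImD) !mulrDl. Qed.

Lemma scN r z : sc (- r) z = - sc r z.
Proof. by apply: eqC3 => j; rewrite !(Re_sc, Im_sc, ReN, ImN) !mulNr. Qed.

Lemma scDr r z w : sc r (z + w) = sc r z + sc r w.
Proof. by apply: eqC3 => j; rewrite !(Re_sc, Im_sc, ReD, ImD) !mulrDr. Qed.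

Lemma scA r t z : sc r (sc t z) = sc (r * t) z.
Proof. by apply: eqC3 => j; rewrite !(Re_sc, Im_sc) !mulrA. Qed.

Lemma scCA r t z : sc r (sc t z) = sc t (sc r z).
Proof. by rewrite !scA mulrC. Qed.

Lemma sc1 z : sc 1 z = z.
Proof. by apply: eqC3 => j; rewrite !(Re_sc, Im_sc) !mul1r. Qed.

Lemma sc0 z : sc 0 z = 0.
Proof. by apply: eqC3 => j; rewrite !(Re_sc, Im_sc) !mul0r mxE. Qed.

(** Orthonormality for the Hermitian product, in terms of its real part. *)
Definition unitary_triple f0 f1 f2 :=
  [/\ ip f0 f0 = 1, ip f1 f1 = 1 & ip f2 f2 = 1] /\
  [/\ ip f0 f1 = 0, ip f0 f2 = 0 & ip f1 f2 = 0] /\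
  [/\ ip f0 (mI f1) = 0, ip f0 (mI f2) = 0 & ip f1 (mI f2) = 0].

Lemma hermE z w : herm z w = (ip z w +i* ip z (mI w))%C.
Proof.
apply/eqP; rewrite eq_complex /= !unlock eqxx /= /inner /herm; apply/eqP.
rewrite !raddf_sum /=; apply: eq_bigr => j _; rewrite !mxE.
by case: (z 0 j) (w 0 j) => a b [c d] /=; ring.
Qed.

(** The adjoint of a unitary matrix is a two-sided inverse, so the three vectors
    and their multiples by [i] form an orthonormal basis over the reals. *)
Lemma parseval f0 f1 f2 z w : unitary_triple f0 f1 f2 ->
  ip z w =
    (ip z f0 * ip w f0 + ip z (mI f0) * ip w (mI f0)) +
    (ip z f1 * ip w f1 + ip z (mI f1) * ip w (mI f1)) +
    (ip z f2 * ip w f2 + ip z (mI f2) * ip w (mI f2)).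
Proof.
move=> [[i00 i11 i22] [[i01 i02 i12] [j01 j02 j12]]].
pose f (a : 'I_3) := nth f0 [:: f0; f1; f2] a.
pose U : 'M[R[i]]_3 := \matrix_(a, j) f a 0 j.
pose V : 'M[R[i]]_3 := \matrix_(j, a) conjc (f a 0 j).
have sw (x y : 'C3[R]) : ip x (mI y) = - ip y (mI x) by rewrite ipC ip_mIl.
have UV : U *m V = 1%:M.
  apply/matrixP => a b; rewrite !mxE.
  transitivity (herm (f a) (f b)); first by apply: eq_bigr => j _; rewrite !mxE.
  rewrite hermE; apply/eqP; rewrite eq_complex; apply/andP.
  case: a b => -[|[|[|//]]] ? [[|[|[|//]]] ?]; rewrite /f /= ?ip_mI //;
   rewrite ?(sw f1 f0) ?(sw f2 f0) ?(sw f2 f1) ?(ipC f1 f0) ?(ipC f2 f0) ?(ipC f2 f1)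
     ?i00 ?i11 ?i22 ?i01 ?i02 ?i12 ?j01 ?j02 ?j12 ?oppr0 //.
have VU := mulmx1C UV.
have key : herm z w = \sum_a herm z (f a) * conjc (herm w (f a)).
  pose wc : 'cV[R[i]]_3 := \col_j conjc (w 0 j).
  transitivity ((z *m wc) 0 0).
    by rewrite mxE; apply: eq_bigr => j _; rewrite !mxE.
  rewrite -[wc]mul1mx -VU -mulmxA mulmxA mxE; apply: eq_bigr => a _.
  congr (_ * _); first by rewrite mxE; apply: eq_bigr => j _; rewrite !mxE.
  rewrite mxE /herm rmorph_sum /=; apply: eq_bigr => j _; rewrite !mxE.
  by rewrite rmorphM /= conjcK mulrC.
rewrite {1}unlock /inner key !big_ord_recl big_ord0 addr0 !hermE /f /=; ring.
Qed.

End hermitian.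

(** * Derivatives along vector fields *)

(** Sealed for the same reason as [ip]. *)
HB.lock Definition partial (R : realType) (k : 'I_2) (f : 'rV[R]_2 -> R)
  (u : 'rV[R]_2) : R := pd k f u.
HB.lock Definition partialC3 (R : realType) (k : 'I_2) (Y : 'rV[R]_2 -> 'C3[R])
  (u : 'rV[R]_2) : 'C3[R] := pdC3 k Y u.
Canonical partial_unlockable := Unlockable partial.unlock.
Canonical partialC3_unlockable := Unlockable partialC3.unlock.

Section rules.
Variable R : realType.
Local Notation Re := complex.Re.
Local Notation Im := complex.Im.
Implicit Types (f g : 'rV[R]_2 -> R) (u : 'rV[R]_2) (k : 'I_2).
Implicit Types (Y Z : 'rV[R]_2 -> 'C3[R]).

Lemma sum2 (V : nmodType) (F : 'I_2 -> V) : \sum_k F k = F 0 + F 1.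
Proof. by rewrite big_ord_recl big_ord1; congr (_ + F _); exact/val_inj. Qed.

Lemma pd_derivable f k u : differentiable f u -> derivable f u 'e_k.
Proof. by move=> df; exact: diff_derivable df. Qed.

Lemma pdD f g k u : differentiable f u -> differentiable g u ->
  partial k (fun w => f w + g w) u = partial k f u + partial k g u.
Proof. by rewrite unlock => /pd_derivable df /pd_derivable dg; exact: deriveD. Qed.

Lemma pdN f k u : differentiable f u -> partial k (fun w => - f w) u = - partial k f u.
Proof. by rewrite unlock => /pd_derivable df; exact: deriveN. Qed.

Lemma pdM f g k u : differentiable f u -> differentiable g u ->
  partial k (fun w => f w * g w) u = partial k f u * g u + f u * partial k g u.
Proof.
rewrite unlock => /pd_derivable df /pd_derivable dg; rewrite addrC [pd k f u * _]mulrC.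
exact: (deriveM (df k) (dg k)).
Qed.

Lemma pd_cst (r : R) k u : partial k (fun=> r) u = 0.
Proof. by rewrite unlock; exact: derive_cst. Qed.

Lemma pd_sum n (F : 'I_n -> 'rV[R]_2 -> R) k u :
  (forall j, differentiable (F j) u) ->
  partial k (fun w => \sum_j F j w) u = \sum_j partial k (F j) u.
Proof.
move=> dF; rewrite unlock /pd -derive_sum; last by move=> j; exact: pd_derivable.
have -> // : (fun w => \sum_j F j w) = \sum_j F j.
by apply/funext => w; rewrite fct_sumE.
Qed.

Lemma diff_sum n (F : 'I_n -> 'rV[R]_2 -> R) u :
  (forall j, differentiable (F j) u) -> differentiable (fun w => \sum_j F j w) u.
Proof.
move=> dF; have -> : (fun w => \sum_j F j w) = \sum_j F j.
  by apply/funext => w; rewrite fct_sumE.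
exact: differentiable_sum.
Qed.

Lemma diffDf f g u : differentiable f u -> differentiable g u ->
  differentiable (fun w => f w + g w) u.
Proof. exact: differentiableD. Qed.

Lemma diffNf f u : differentiable f u -> differentiable (fun w => - f w) u.
Proof. exact: differentiableN. Qed.

Lemma diffMf f g u : differentiable f u -> differentiable g u ->
  differentiable (fun w => f w * g w) u.
Proof. exact: differentiableM. Qed.

Lemma diffVf f u : differentiable f u -> f u != 0 ->
  differentiable (fun w => (f w)^-1) u.
Proof. exact: differentiableV. Qed.

Definition diffC3 Y u := forall j : 'I_3,
  differentiable (fun w => Re (Y w 0 j)) u /\ differentiable (fun w => Im (Y w 0 j)) u.

Lemma Re_pdC3 Y k u j : Re (partialC3 k Y u 0 j) = partial k (fun w => Re (Y w 0 j)) u.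
Proof. by rewrite !unlock mxE. Qed.

Lemma Im_pdC3 Y k u j : Im (partialC3 k Y u 0 j) = partial k (fun w => Im (Y w 0 j)) u.
Proof. by rewrite !unlock mxE. Qed.

Lemma diff_ip Y Z u : diffC3 Y u -> diffC3 Z u ->
  differentiable (fun w => ip (Y w) (Z w)) u.
Proof.
move=> dY dZ; under eq_fun do rewrite ipE.
by apply: diff_sum => j; have [? ?] := dY j; have [? ?] := dZ j; apply: diffDf; apply: diffMf.
Qed.

Lemma pd_ip Y Z k u : diffC3 Y u -> diffC3 Z u ->
  partial k (fun w => ip (Y w) (Z w)) u
  = ip (partialC3 k Y u) (Z u) + ip (Y u) (partialC3 k Z u).
Proof.
move=> dY dZ; under eq_fun do rewrite ipE.
rewrite pd_sum => [|j]; last first.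
  by have [? ?] := dY j; have [? ?] := dZ j; apply: diffDf; apply: diffMf.
rewrite !ipE -big_split; apply: eq_bigr => j _.
have [dY1 dY2] := dY j; have [dZ1 dZ2] := dZ j.
rewrite (pdD k (diffMf dY1 dZ1) (diffMf dY2 dZ2)) (pdM k dY1 dZ1) (pdM k dY2 dZ2).
by rewrite !Re_pdC3 !Im_pdC3; exact: addrACA.
Qed.

Lemma diffC3D Y Z u : diffC3 Y u -> diffC3 Z u -> diffC3 (fun w => Y w + Z w) u.
Proof.
move=> dY dZ j; have [? ?] := dY j; have [? ?] := dZ j.
by split; [under eq_fun do rewrite ReD|under eq_fun do rewrite ImD]; exact: diffDf.
Qed.

Lemma pdC3D Y Z k u : diffC3 Y u -> diffC3 Z u ->
  partialC3 k (fun w => Y w + Z w) u = partialC3 k Y u + partialC3 k Z u.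
Proof.
move=> dY dZ; apply: eqC3 => j; have [dY1 dY2] := dY j; have [dZ1 dZ2] := dZ j.
rewrite ReD ImD !Re_pdC3 !Im_pdC3.
rewrite -(pdD k dY1 dZ1) -(pdD k dY2 dZ2).
by split; congr (partial k _ u); apply/funext => w; rewrite ?ReD ?ImD.
Qed.

Lemma diffC3Z f Y u : differentiable f u -> diffC3 Y u ->
  diffC3 (fun w => sc (f w) (Y w)) u.
Proof.
move=> df dY j; have [? ?] := dY j.
by split; [under eq_fun do rewrite Re_sc|under eq_fun do rewrite Im_sc]; exact: diffMf.
Qed.

Lemma pdC3Z f Y k u : differentiable f u -> diffC3 Y u ->
  partialC3 k (fun w => sc (f w) (Y w)) u
  = sc (partial k f u) (Y u) + sc (f u) (partialC3 k Y u).
Proof.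
move=> df dY; apply: eqC3 => j; have [dY1 dY2] := dY j.
rewrite ReD ImD !Re_sc !Im_sc !Re_pdC3 !Im_pdC3.
rewrite -(pdM k df dY1) -(pdM k df dY2).
by split; congr (partial k _ u); apply/funext => w; rewrite ?Re_sc ?Im_sc.
Qed.

Lemma diffC3I Y u : diffC3 Y u -> diffC3 (fun w => mI (Y w)) u.
Proof.
move=> dY j; have [? ?] := dY j.
split; [under eq_fun do rewrite Re_mI; exact: diffNf|by under eq_fun do rewrite Im_mI].
Qed.

Lemma pdC3I Y k u : diffC3 Y u -> partialC3 k (fun w => mI (Y w)) u = mI (partialC3 k Y u).
Proof.
move=> dY; apply: eqC3 => j; have [dY1 dY2] := dY j.
rewrite Re_mI Im_mI !Re_pdC3 !Im_pdC3.
rewrite -(pdN k dY2).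
by split; congr (partial k _ u); apply/funext => w; rewrite ?Re_mI ?Im_mI.
Qed.

End rules.

HB.lock Definition vder (R : realType) (V : 'I_2 -> 'rV[R]_2 -> R)
    (f : 'rV[R]_2 -> R) (u : 'rV[R]_2) : R :=
  V 0 u * partial 0 f u + V 1 u * partial 1 f u.
HB.lock Definition vderC3 (R : realType) (V : 'I_2 -> 'rV[R]_2 -> R)
    (Y : 'rV[R]_2 -> 'C3[R]) (u : 'rV[R]_2) : 'C3[R] :=
  sc (V 0 u) (partialC3 0 Y u) + sc (V 1 u) (partialC3 1 Y u).
Canonical vder_unlockable := Unlockable vder.unlock.
Canonical vderC3_unlockable := Unlockable vderC3.unlock.

Section derivations.
Variable R : realType.
Local Notation Re := complex.Re.
Local Notation Im := complex.Im.
Implicit Types (f g : 'rV[R]_2 -> R) (u : 'rV[R]_2) (k : 'I_2).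
Implicit Types (Y Z : 'rV[R]_2 -> 'C3[R]) (V W : 'I_2 -> 'rV[R]_2 -> R).

Lemma near_eq_partial k f g u : (\forall w \near u, f w = g w) ->
  partial k f u = partial k g u.
Proof. by rewrite unlock; exact: near_eq_pd. Qed.

Lemma vderE V f u : vder V f u = V 0 u * partial 0 f u + V 1 u * partial 1 f u.
Proof. by rewrite unlock. Qed.

Lemma vderC3E V Y u :
  vderC3 V Y u = sc (V 0 u) (partialC3 0 Y u) + sc (V 1 u) (partialC3 1 Y u).
Proof. by rewrite unlock. Qed.

Lemma vderD V f g u : differentiable f u -> differentiable g u ->
  vder V (fun w => f w + g w) u = vder V f u + vder V g u.
Proof.
move=> df dg; rewrite !vderE (pdD 0 df dg) (pdD 1 df dg).
by rewrite !mulrDr addrACA.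
Qed.

Lemma vderN V f u : differentiable f u -> vder V (fun w => - f w) u = - vder V f u.
Proof. by move=> df; rewrite !vderE (pdN 0 df) (pdN 1 df) !mulrN opprD. Qed.

Lemma vderM V f g u : differentiable f u -> differentiable g u ->
  vder V (fun w => f w * g w) u = vder V f u * g u + f u * vder V g u.
Proof.
move=> df dg; rewrite !vderE (pdM 0 df dg) (pdM 1 df dg).
move: (partial 0 f u) (partial 1 f u) (partial 0 g u) (partial 1 g u) => x y z t; ring.
Qed.

Lemma vder_cst V (r : R) u : vder V (fun=> r) u = 0.
Proof. by rewrite !vderE !pd_cst !mulr0 addr0. Qed.

Lemma near_eq_vder V f g u : (\forall w \near u, f w = g w) -> vder V f u = vder V g u.
Proof. by move=> fg; rewrite !vderE (near_eq_partial 0 fg) (near_eq_partial 1 fg). Qed.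

Lemma near_eq_pdC3 k Y Z u : (\forall w \near u, Y w = Z w) -> partialC3 k Y u = partialC3 k Z u.
Proof.
move=> YZ; apply: eqC3 => j; rewrite !Re_pdC3 !Im_pdC3.
by split; apply: near_eq_partial; apply: filterS YZ => w ->.
Qed.

Lemma near_eq_vderC3 V Y Z u : (\forall w \near u, Y w = Z w) -> vderC3 V Y u = vderC3 V Z u.
Proof. by move=> YZ; rewrite !vderC3E (near_eq_pdC3 0 YZ) (near_eq_pdC3 1 YZ). Qed.

Lemma vder_ip V Y Z u : diffC3 Y u -> diffC3 Z u ->
  vder V (fun w => ip (Y w) (Z w)) u
  = ip (vderC3 V Y u) (Z u) + ip (Y u) (vderC3 V Z u).
Proof.
move=> dY dZ; rewrite !vderE (pd_ip 0 dY dZ) (pd_ip 1 dY dZ).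
rewrite !vderC3E ipDl ipDr !ipZl !ipZr !mulrDr.
by rewrite addrACA.
Qed.

Lemma vderC3D V Y Z u : diffC3 Y u -> diffC3 Z u ->
  vderC3 V (fun w => Y w + Z w) u = vderC3 V Y u + vderC3 V Z u.
Proof.
move=> dY dZ; rewrite !vderC3E (pdC3D 0 dY dZ) (pdC3D 1 dY dZ).
rewrite (scDr _ (partialC3 0 Y u)) (scDr _ (partialC3 1 Y u)).
exact: addrACA.
Qed.

Lemma vderC3Z V f Y u : differentiable f u -> diffC3 Y u ->
  vderC3 V (fun w => sc (f w) (Y w)) u
  = sc (vder V f u) (Y u) + sc (f u) (vderC3 V Y u).
Proof.
move=> df dY; rewrite !vderC3E (pdC3Z 0 df dY) (pdC3Z 1 df dY) !vderE scDl.
rewrite (scDr (V 0 u)) (scDr (V 1 u)) (scDr (f u)) !(scCA (f u)).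
by rewrite (scA (V 0 u) (partial 0 f u)) (scA (V 1 u) (partial 1 f u)) addrACA.
Qed.

Lemma vderC3I V Y u : diffC3 Y u ->
  vderC3 V (fun w => mI (Y w)) u = mI (vderC3 V Y u).
Proof. by move=> dY; rewrite !vderC3E (pdC3I 0 dY) (pdC3I 1 dY) mID !mIZ. Qed.

Lemma vder_vder V W f u :
  (forall k, differentiable (W k) u) -> (forall k, differentiable (partial k f) u) ->
  vder V (vder W f) u = vder V (W 0) u * partial 0 f u + W 0 u * vder V (partial 0 f) u +
                       (vder V (W 1) u * partial 1 f u + W 1 u * vder V (partial 1 f) u).
Proof.
move=> dW df; have -> : vder W f = fun w => W 0 w * partial 0 f w + W 1 w * partial 1 f w.
  by apply/funext => w; exact: vderE.
rewrite (vderD V (diffMf (dW 0) (df 0)) (diffMf (dW 1) (df 1))).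
by rewrite (vderM V (dW 0) (df 0)) (vderM V (dW 1) (df 1)).
Qed.

(** By symmetry the second derivatives of [f] cancel in the commutator, and only
    derivatives of the coefficients of [V] and [W] remain. *)
Lemma vder_bracket V W f u :
  (forall k, differentiable (V k) u) -> (forall k, differentiable (W k) u) ->
  (forall k, differentiable (partial k f) u) -> partial 0 (partial 1 f) u = partial 1 (partial 0 f) u ->
  vder V (vder W f) u - vder W (vder V f) u =
    (vder V (W 0) u - vder W (V 0) u) * partial 0 f u +
    (vder V (W 1) u - vder W (V 1) u) * partial 1 f u.
Proof.
move=> dV dW df E; rewrite (vder_vder V dW df) (vder_vder W dV df).
rewrite (vderE V (partial 0 f)) (vderE V (partial 1 f)) (vderE W (partial 0 f)) (vderE W (partial 1 f)) E.
move: (vder V (W 0) u) (vder V (W 1) u) (vder W (V 0) u) (vder W (V 1) u).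
move: (partial 0 (partial 0 f) u) (partial 1 (partial 0 f) u) (partial 1 (partial 1 f) u) (partial 0 f u) (partial 1 f u).
by move: (V 0 u) (V 1 u) (W 0 u) (W 1 u) => *; ring.
Qed.

Lemma Re_vderC3 V Y j :
  (fun w => Re (vderC3 V Y w 0 j)) = vder V (fun w => Re (Y w 0 j)).
Proof. by apply/funext => u; rewrite vderC3E vderE ReD !Re_sc !Re_pdC3. Qed.

Lemma Im_vderC3 V Y j :
  (fun w => Im (vderC3 V Y w 0 j)) = vder V (fun w => Im (Y w 0 j)).
Proof. by apply/funext => u; rewrite vderC3E vderE ImD !Im_sc !Im_pdC3. Qed.

Lemma vderC3_bracket V W Y u :
  (forall k, differentiable (V k) u) -> (forall k, differentiable (W k) u) ->
  (forall k, diffC3 (partialC3 k Y) u) -> partialC3 0 (partialC3 1 Y) u = partialC3 1 (partialC3 0 Y) u ->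
  vderC3 V (vderC3 W Y) u - vderC3 W (vderC3 V Y) u =
    sc (vder V (W 0) u - vder W (V 0) u) (partialC3 0 Y u) +
    sc (vder V (W 1) u - vder W (V 1) u) (partialC3 1 Y u).
Proof.
move=> dV dW dY E; apply: eqC3 => j.
have pR k : (fun w => Re (partialC3 k Y w 0 j)) = partial k (fun w => Re (Y w 0 j)).
  by apply/funext => w; rewrite Re_pdC3.
have pI k : (fun w => Im (partialC3 k Y w 0 j)) = partial k (fun w => Im (Y w 0 j)).
  by apply/funext => w; rewrite Im_pdC3.
have rR A B : Re (vderC3 A (vderC3 B Y) u 0 j) = vder A (vder B (fun w => Re (Y w 0 j))) u.
  by have := congr1 (@^~ u) (Re_vderC3 A (vderC3 B Y) j); rewrite Re_vderC3.
have rI A B : Im (vderC3 A (vderC3 B Y) u 0 j) = vder A (vder B (fun w => Im (Y w 0 j))) u.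
  by have := congr1 (@^~ u) (Im_vderC3 A (vderC3 B Y) j); rewrite Im_vderC3.
rewrite !(ReD, ImD, ReN, ImN) !Re_sc !Im_sc !Re_pdC3 !Im_pdC3 !rR !rI.
split; apply: vder_bracket => //.
- by move=> k; rewrite -pR; have [] := dY k j.
- by rewrite -!pR -!Re_pdC3 E.
- by move=> k; rewrite -pI; have [] := dY k j.
- by rewrite -!pI -!Im_pdC3 E.
Qed.

End derivations.

Section smooth_fields.
Variables (R : realType) (W : set 'rV[R]_2).
Hypothesis oW : open W.
Local Notation Re := complex.Re.
Local Notation Im := complex.Im.
Implicit Types (Y Z : 'rV[R]_2 -> 'C3[R]) (u : 'rV[R]_2) (k i j : 'I_2).

Lemma partialE k : @partial R k = @pd R k.
Proof. by rewrite unlock. Qed.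

Lemma partialC3E k : @partialC3 R k = @pdC3 R k.
Proof. by rewrite unlock. Qed.

Lemma smoothC3_diff Y u : smoothC3 W Y -> W u -> diffC3 Y u.
Proof. by move=> sY Wu j; have [sR sI] := sY j; split; exact: smooth_diff Wu. Qed.

Lemma smoothC3_partial Y k : smoothC3 W Y -> smoothC3 W (partialC3 k Y).
Proof.
move=> sY j; have [sR sI] := sY j.
have -> : (fun w => Re (partialC3 k Y w 0 j)) = pd k (fun w => Re (Y w 0 j)).
  by apply/funext => w; rewrite Re_pdC3 partialE.
have -> : (fun w => Im (partialC3 k Y w 0 j)) = pd k (fun w => Im (Y w 0 j)).
  by apply/funext => w; rewrite Im_pdC3 partialE.
by split; exact: smooth_pd.
Qed.

Lemma partialC3_comm Y u i j : smoothC3 W Y -> W u ->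
  partialC3 i (partialC3 j Y) u = partialC3 j (partialC3 i Y) u.
Proof.
move=> sY Wu; apply: eqC3 => l; have [sR sI] := sY l.
rewrite !Re_pdC3 !Im_pdC3; split.
  have E k : (fun w => Re (partialC3 k Y w 0 l)) = pd k (fun w => Re (Y w 0 l)).
    by apply/funext => w; rewrite Re_pdC3 partialE.
  by rewrite !E !partialE; exact: schwarz oW Wu sR.
have E k : (fun w => Im (partialC3 k Y w 0 l)) = pd k (fun w => Im (Y w 0 l)).
  by apply/funext => w; rewrite Im_pdC3 partialE.
by rewrite !E !partialE; exact: schwarz oW Wu sI.
Qed.

Lemma partialC3_diff Y u k : smoothC3 W Y -> W u -> diffC3 (partialC3 k Y) u.
Proof. by move=> /(@smoothC3_partial _ k); exact: smoothC3_diff. Qed.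

Lemma near_in u : W u -> \forall w \near u, W w.
Proof. by move=> Wu; exact: open_nbhs_nbhs. Qed.

End smooth_fields.

(** * Orthonormal frames of a surface *)

Record orthonormal_frame (R : realType) (W : set 'rV[R]_2)
    (X e1 e2 : 'rV[R]_2 -> 'C3[R]) : Prop := OrthonormalFrame {
  frame_open : open W;
  frame_X : smoothC3 W X;
  frame_e1 : smoothC3 W e1;
  frame_e2 : smoothC3 W e2;
  frame_tan1 : forall w, W w -> tangent X w (e1 w);
  frame_tan2 : forall w, W w -> tangent X w (e2 w);
  frame_11 : forall w, W w -> ip (e1 w) (e1 w) = 1;
  frame_22 : forall w, W w -> ip (e2 w) (e2 w) = 1;
  frame_12 : forall w, W w -> ip (e1 w) (e2 w) = 0
}.

Section local_frame.
Variables (R : realType) (W : set 'rV[R]_2) (X e1 e2 : 'rV[R]_2 -> 'C3[R]).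
Hypothesis Fr : orthonormal_frame W X e1 e2.
Let oW : open W. Proof. by case: Fr. Qed.
Let sX : smoothC3 W X. Proof. by case: Fr. Qed.
Let se1 : smoothC3 W e1. Proof. by case: Fr. Qed.
Let se2 : smoothC3 W e2. Proof. by case: Fr. Qed.
Let tan1 w : W w -> tangent X w (e1 w). Proof. exact: frame_tan1 Fr w. Qed.
Let tan2 w : W w -> tangent X w (e2 w). Proof. exact: frame_tan2 Fr w. Qed.
Let e11 w : W w -> ip (e1 w) (e1 w) = 1. Proof. exact: frame_11 Fr w. Qed.
Let e22 w : W w -> ip (e2 w) (e2 w) = 1. Proof. exact: frame_22 Fr w. Qed.
Let e12 w : W w -> ip (e1 w) (e2 w) = 0. Proof. exact: frame_12 Fr w. Qed.

Definition theta (e : 'rV[R]_2 -> 'C3[R]) (k : 'I_2) (w : 'rV[R]_2) : R :=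
  ip (partialC3 k X w) (e w).

Definition area (w : 'rV[R]_2) : R :=
  theta e1 0 w * theta e2 1 w - theta e1 1 w * theta e2 0 w.

(** The vector fields of the plane dual to the coframe, hence mapped by the
    differential of [X] to [e1] and [e2]. *)
Definition E1 (k : 'I_2) (w : 'rV[R]_2) : R :=
  if k == 0 then theta e2 1 w / area w else - theta e2 0 w / area w.
Definition E2 (k : 'I_2) (w : 'rV[R]_2) : R :=
  if k == 0 then - theta e1 1 w / area w else theta e1 0 w / area w.

Let dX u : W u -> diffC3 X u. Proof. exact: smoothC3_diff. Qed.
Let de1 u : W u -> diffC3 e1 u. Proof. exact: smoothC3_diff. Qed.
Let de2 u : W u -> diffC3 e2 u. Proof. exact: smoothC3_diff. Qed.

Lemma tangent_theta w v : tangent X w v ->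
  exists m : 'I_2 -> R, v = sc (m 0) (partialC3 0 X w) + sc (m 1) (partialC3 1 X w) /\
     (forall e, ip v (e w) = m 0 * theta e 0 w + m 1 * theta e 1 w).
Proof.
move=> [m ->]; exists m; rewrite sum2 /theta !partialC3E !scale_sc.
by split=> // e; rewrite ipDl !ipZl.
Qed.

(** The coefficients of the frame in the coordinate basis form the inverse of the
    matrix of the coframe; in particular [X] is an immersion. *)
Lemma frame_dual w : W w ->
  [/\ area w != 0,
      partialC3 0 X w = sc (theta e1 0 w) (e1 w) + sc (theta e2 0 w) (e2 w) &
      partialC3 1 X w = sc (theta e1 1 w) (e1 w) + sc (theta e2 1 w) (e2 w)].
Proof.
move=> Ww.
have [m [m1 m1E]] := tangent_theta (tan1 Ww).
have [l [l1 l1E]] := tangent_theta (tan2 Ww).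
have := m1E e1; have := m1E e2; have := l1E e1; have := l1E e2.
rewrite (e11 Ww) (e22 Ww) (e12 Ww) ipC (e12 Ww) /area.
move: (theta e1 0 w) (theta e1 1 w) (theta e2 0 w) (theta e2 1 w) => a b c d.
move=> h22 h21 h12 h11.
have D : (m 0 * l 1 - m 1 * l 0) * (a * d - b * c) = 1.
  have -> : (m 0 * l 1 - m 1 * l 0) * (a * d - b * c) =
    (m 0 * a + m 1 * b) * (l 0 * c + l 1 * d) - (m 0 * c + m 1 * d) * (l 0 * a + l 1 * b).
    ring.
  by rewrite -h11 -h12 -h21 -h22; ring.
have D0 : a * d - b * c != 0.
  by apply/eqP => z; move: D; rewrite z mulr0 => /eqP; rewrite eq_sym oner_eq0.
have inv (x y z t : R) : x * a + y * b = z -> x * c + y * d = t ->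
    x * (a * d - b * c) = z * d - t * b /\ y * (a * d - b * c) = t * a - z * c.
  by move=> <- <-; split; ring.
have [m0E m1'E] := inv _ _ _ _ (esym h11) (esym h12).
have [l0E l1'E] := inv _ _ _ _ (esym h21) (esym h22).
have m0 : m 0 = d / (a * d - b * c) by apply: (mulIf D0); rewrite m0E divfK //; ring.
have m1' : m 1 = - c / (a * d - b * c) by apply: (mulIf D0); rewrite m1'E divfK //; ring.
have l0 : l 0 = - b / (a * d - b * c) by apply: (mulIf D0); rewrite l0E divfK //; ring.
have l1' : l 1 = a / (a * d - b * c) by apply: (mulIf D0); rewrite l1'E divfK //; ring.
split=> //; rewrite m1 l1 !scDr !scA m0 m1' l0 l1'.
  rewrite addrACA -!scDl.
  have -> : a * (d / (a * d - b * c)) + c * (- b / (a * d - b * c)) = 1 by field.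
  have -> : a * (- c / (a * d - b * c)) + c * (a / (a * d - b * c)) = 0 by field.
  by rewrite sc1 sc0 addr0.
rewrite addrACA -!scDl.
have -> : b * (d / (a * d - b * c)) + d * (- b / (a * d - b * c)) = 0 by field.
have -> : b * (- c / (a * d - b * c)) + d * (a / (a * d - b * c)) = 1 by field.
by rewrite sc1 sc0 add0r.
Qed.

Lemma partial_frame f w k : W w ->
  partial k f w = theta e1 k w * vder E1 f w + theta e2 k w * vder E2 f w.
Proof.
move=> Ww; have [A0 _ _] := frame_dual Ww.
rewrite !vderE /E1 /E2 /=.
have [->|->] : k = 0 \/ k = 1 by case: k => -[|[|//]] ?; [left|right]; exact/val_inj.
  by move: A0; rewrite /area; move: (partial 0 f w) (partial 1 f w) => x y A0; field.
by move: A0; rewrite /area; move: (partial 0 f w) (partial 1 f w) => x y A0; field.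
Qed.

Lemma partialC3_frame Y w k : W w ->
  partialC3 k Y w = sc (theta e1 k w) (vderC3 E1 Y w) + sc (theta e2 k w) (vderC3 E2 Y w).
Proof.
move=> Ww; apply: eqC3 => j; rewrite ReD ImD !Re_sc !Im_sc.
have R1 V := congr1 (@^~ w) (Re_vderC3 V Y j).
have I1 V := congr1 (@^~ w) (Im_vderC3 V Y j).
by rewrite /= in R1 I1; rewrite !R1 !I1 Re_pdC3 Im_pdC3; split; exact: partial_frame.
Qed.

Lemma vder_X w : W w -> vderC3 E1 X w = e1 w /\ vderC3 E2 X w = e2 w.
Proof.
move=> Ww; have [A0 X0 X1] := frame_dual Ww.
rewrite !vderC3E X0 X1 /E1 /E2 /= !scDr !scA; move: A0; rewrite /area.
move: (theta e1 0 w) (theta e1 1 w) (theta e2 0 w) (theta e2 1 w) => a b c d A0.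
split; rewrite addrACA -!scDl.
  have -> : d / (a * d - b * c) * a + - c / (a * d - b * c) * b = 1 by field.
  have -> : d / (a * d - b * c) * c + - c / (a * d - b * c) * d = 0 by field.
  by rewrite sc1 sc0 addr0.
have -> : - b / (a * d - b * c) * a + a / (a * d - b * c) * b = 0 by field.
have -> : - b / (a * d - b * c) * c + a / (a * d - b * c) * d = 1 by field.
by rewrite sc1 sc0 add0r.
Qed.

Lemma theta_diff e k w : W w -> diffC3 e w -> differentiable (theta e k) w.
Proof. by move=> Ww de; apply: diff_ip => //; exact: partialC3_diff Ww. Qed.

Lemma E1_diff w k : W w -> differentiable (E1 k) w.
Proof.
move=> Ww; have [A0 _ _] := frame_dual Ww.
have dt e l : diffC3 e w -> differentiable (theta e l) w by exact: theta_diff.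
have dA : differentiable area w.
  by apply: diffDf; [|apply: diffNf]; apply: diffMf; apply: dt; auto.
rewrite /E1; case: (k == 0); apply: diffMf; try exact: diffVf; try apply: diffNf;
  apply: dt; auto.
Qed.

Lemma E2_diff w k : W w -> differentiable (E2 k) w.
Proof.
move=> Ww; have [A0 _ _] := frame_dual Ww.
have dt e l : diffC3 e w -> differentiable (theta e l) w by exact: theta_diff.
have dA : differentiable area w.
  by apply: diffDf; [|apply: diffNf]; apply: diffMf; apply: dt; auto.
rewrite /E2; case: (k == 0); apply: diffMf; try exact: diffVf; try apply: diffNf;
  apply: dt; auto.
Qed.

(** Components of the connection form [theta_1^2] on the frame. *)
Definition omega1 w := ip (vderC3 E1 e1 w) (e2 w).
Definition omega2 w := ip (vderC3 E2 e1 w) (e2 w).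

Lemma vder_cst_ip V Y Z (r : R) w : W w -> diffC3 Y w -> diffC3 Z w ->
  (forall w, W w -> ip (Y w) (Z w) = r) ->
  ip (vderC3 V Y w) (Z w) = - ip (Y w) (vderC3 V Z w).
Proof.
move=> Ww dY dZ YZ; have := vder_ip V dY dZ.
rewrite (@near_eq_vder _ _ _ (fun=> r)); last first.
  by apply: filterS (near_in oW Ww) => x; exact: YZ.
rewrite vder_cst => /esym/eqP; rewrite addr_eq0 => /eqP.
done.
Qed.

Lemma vder_ip_unit V Y w : W w -> diffC3 Y w ->
  (forall w, W w -> ip (Y w) (Y w) = 1) -> ip (vderC3 V Y w) (Y w) = 0.
Proof.
move=> Ww dY Y1; have := vder_cst_ip V Ww dY dY Y1.
by rewrite ipC; move: (ip _ _) => x; lra.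
Qed.

Let e21 w : W w -> ip (e2 w) (e1 w) = 0. Proof. by rewrite ipC; exact: e12. Qed.

(** The bracket of the dual fields maps [X] to a tangent vector, whose components
    only involve the connection form since the frame is orthonormal. *)
Lemma torsion_free w : W w ->
  vderC3 E1 e2 w - vderC3 E2 e1 w = - (sc (omega1 w) (e1 w) + sc (omega2 w) (e2 w)) /\
  ((vder E1 (E2 0) w - vder E2 (E1 0) w) * theta e1 0 w +
      (vder E1 (E2 1) w - vder E2 (E1 1) w) * theta e1 1 w = - omega1 w /\
      (vder E1 (E2 0) w - vder E2 (E1 0) w) * theta e2 0 w +
      (vder E1 (E2 1) w - vder E2 (E1 1) w) * theta e2 1 w = - omega2 w).
Proof.
move=> Ww.
have B : vderC3 E1 e2 w - vderC3 E2 e1 w =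
   sc (vder E1 (E2 0) w - vder E2 (E1 0) w) (partialC3 0 X w) +
   sc (vder E1 (E2 1) w - vder E2 (E1 1) w) (partialC3 1 X w).
  rewrite -vderC3_bracket; last first.
  - exact: (partialC3_comm oW 0 1 sX Ww).
  - by move=> k; exact: partialC3_diff sX Ww.
  - by move=> k; exact: E2_diff.
  - by move=> k; exact: E1_diff.
  congr (_ - _); apply: near_eq_vderC3; apply: filterS (near_in oW Ww) => x Wx;
    by have [H1 H2] := vder_X Wx; rewrite ?H1 ?H2.
move: (vder E1 (E2 0) w - vder E2 (E1 0) w) (vder E1 (E2 1) w - vder E2 (E1 1) w) B => b0 b1 B.
have I1 : b0 * theta e1 0 w + b1 * theta e1 1 w = - omega1 w.
  have := congr1 (fun v => ip v (e1 w)) B; rewrite ipDl ipNl [in RHS]ipDl !ipZl => <-.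
  rewrite (vder_ip_unit E2 Ww (de1 Ww) e11) subr0.
  by rewrite (vder_cst_ip E1 Ww (de2 Ww) (de1 Ww) e21) ipC.
have I2 : b0 * theta e2 0 w + b1 * theta e2 1 w = - omega2 w.
  have := congr1 (fun v => ip v (e2 w)) B; rewrite ipDl ipNl [in RHS]ipDl !ipZl => <-.
  by rewrite (vder_ip_unit E1 Ww (de2 Ww) e22) sub0r.
split=> //; rewrite B; have [_ -> ->] := frame_dual Ww.
by rewrite !scDr !scA addrACA -!scDl I1 I2 !scN opprD.
Qed.

Lemma bracketC3 Y w : W w -> smoothC3 W Y ->
  vderC3 E1 (vderC3 E2 Y) w - vderC3 E2 (vderC3 E1 Y) w =
    - (sc (omega1 w) (vderC3 E1 Y w) + sc (omega2 w) (vderC3 E2 Y w)).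
Proof.
move=> Ww sY; rewrite (vderC3_bracket (fun k => E1_diff k Ww) (fun k => E2_diff k Ww)); last first.
- exact: (partialC3_comm oW 0 1 sY Ww).
- by move=> k; exact: partialC3_diff sY Ww.
have [_ [I1 I2]] := torsion_free Ww.
rewrite !(partialC3_frame Y _ Ww) !scDr !scA addrACA -!scDl I1 I2.
by rewrite !scN opprD.
Qed.

Lemma vderC3_diff V Y w : (forall k, differentiable (V k) w) -> W w -> smoothC3 W Y ->
  diffC3 (vderC3 V Y) w.
Proof.
move=> dV Ww sY; have -> : vderC3 V Y =
    fun x => sc (V 0 x) (partialC3 0 Y x) + sc (V 1 x) (partialC3 1 Y x).
  by apply/funext => x; rewrite vderC3E.
by apply: diffC3D; apply: diffC3Z => //; exact: partialC3_diff Ww.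
Qed.

End local_frame.

(** * Contact frames and their structure equations *)

Definition ccos (R : realType) (X e2 : 'rV[R]_2 -> 'C3[R]) (w : 'rV[R]_2) : R :=
  ip (mI (X w)) (e2 w).
Definition csin (R : realType) (X e2 : 'rV[R]_2 -> 'C3[R]) (w : 'rV[R]_2) : R :=
  Num.sqrt (1 - ccos X e2 w ^+ 2).

(** The unit vector completing [X] and [e1] to a unitary frame of C^3. *)
HB.lock Definition third (R : realType) (X e1 e2 : 'rV[R]_2 -> 'C3[R]) (k sg : R)
    (w : 'rV[R]_2) : 'C3[R] :=
  sc (csin X e2 w * sg)^-1
    (e2 w + (sc (- ccos X e2 w) (mI (X w)) + sc (- (csin X e2 w * k)) (mI (e1 w)))).
Canonical third_unlockable := Unlockable third.unlock.

Section contact.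
Variables (R : realType) (X e1 e2 : 'rV[R]_2 -> 'C3[R]) (k sg : R).
Local Notation c := (ccos X e2).
Local Notation s := (csin X e2).
Local Notation n := (third X e1 e2 k sg).

(** An adapted frame of a minimal surface; [k] and [sg] are the cosine and the sine
    of the holomorphic angle, and [sg (i e1) - k (third)] is the normal field [e3]. *)
Record contact_frame (W : set 'rV[R]_2) (a : R) : Prop := ContactFrame {
  contact_orthonormal : orthonormal_frame W X e1 e2;
  contact_sphere : forall w, W w -> ip (X w) (X w) = 1;
  contact_e1 : forall w, W w -> ip (mI (X w)) (e1 w) = 0;
  contact_lt1 : forall w, W w -> c w ^+ 2 < 1;
  contact_ksg : k ^+ 2 + sg ^+ 2 = 1;
  contact_sg : sg != 0;
  contact_kaehler : forall w, W w -> ip (mI (e1 w)) (e2 w) = s w * k;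
  contact_minimal : forall w m, W w ->
    ip (X w) m = 0 -> ip (e1 w) m = 0 -> ip (e2 w) m = 0 ->
    ip (vderC3 (E1 X e1 e2) e1 w + vderC3 (E2 X e1 e2) e2 w) m = 0;
  contact_e3_1 : forall w, W w -> ip (vderC3 (E1 X e1 e2) e1 w)
     (sc sg (mI (e1 w)) + sc (- k) (n w)) = a;
  contact_e3_2 : forall w, W w -> ip (vderC3 (E2 X e1 e2) e1 w)
     (sc sg (mI (e1 w)) + sc (- k) (n w)) = 0
}.

Section structure.
Variables (W : set 'rV[R]_2) (a : R).
Hypothesis Cf : contact_frame W a.
Local Notation D1 := (vderC3 (E1 X e1 e2)).
Local Notation D2 := (vderC3 (E2 X e1 e2)).
Local Notation d1 := (vder (E1 X e1 e2)).
Local Notation d2 := (vder (E2 X e1 e2)).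
Local Notation w1 := (omega1 X e1 e2).
Local Notation w2 := (omega2 X e1 e2).

Let Fr : orthonormal_frame W X e1 e2. Proof. by case: Cf. Qed.
Let oW : open W. Proof. exact: frame_open Fr. Qed.
Let dX w : W w -> diffC3 X w. Proof. exact: smoothC3_diff (frame_X Fr). Qed.
Let de1 w : W w -> diffC3 e1 w. Proof. exact: smoothC3_diff (frame_e1 Fr). Qed.
Let de2 w : W w -> diffC3 e2 w. Proof. exact: smoothC3_diff (frame_e2 Fr). Qed.

Lemma csin_gt0 w : W w -> 0 < s w.
Proof. by move=> Ww; rewrite sqrtr_gt0 subr_gt0; exact: contact_lt1 Cf _ Ww. Qed.

Lemma csin2 w : W w -> c w ^+ 2 + s w ^+ 2 = 1.
Proof.
move=> Ww; rewrite sqr_sqrtr ?subrKC // subr_ge0 ltW //; exact: contact_lt1 Cf _ Ww.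
Qed.

Lemma ccos_diff w : W w -> differentiable c w.
Proof. by move=> Ww; apply: diff_ip; [apply: diffC3I; exact: dX|exact: de2]. Qed.

Lemma csin_diff w : W w -> differentiable s w.
Proof.
move=> Ww.
have p0 : 0 < 1 - c w ^+ 2 by rewrite subr_gt0; exact: contact_lt1 Cf _ Ww.
have dsq : differentiable (@Num.sqrt R) (1 - c w ^+ 2).
  by apply/derivable1_diffP; have [] := is_derive1_sqrt p0.
have dc : differentiable (fun x => 1 - c x ^+ 2) w.
  have -> : (fun x => 1 - c x ^+ 2) = (fun x => 1 + - (c x * c x)).
    by apply/funext => x; rewrite expr2.
  apply: diffDf; first exact: differentiable_cst.
  by apply: diffNf; apply: diffMf; exact: ccos_diff.
exact: (@differentiable_comp _ _ _ _ (fun x => 1 - c x ^+ 2) (@Num.sqrt R) w dc dsq).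
Qed.

Lemma csin_vder V w : W w -> c w * vder V c w + s w * vder V s w = 0.
Proof.
move=> Ww; have dc := ccos_diff Ww; have ds := csin_diff Ww.
have := vderD V (diffMf dc dc) (diffMf ds ds).
rewrite (@near_eq_vder _ _ _ (fun=> 1)); last first.
  by apply: filterS (near_in oW Ww) => x Wx; rewrite -!expr2 csin2.
rewrite vder_cst (vderM V dc dc) (vderM V ds ds).
move: (vder V c w) (vder V s w) (c w) (s w) => x y p q; lra.
Qed.

Lemma csin_neq0 w : W w -> s w != 0.
Proof. by move/csin_gt0/lt0r_neq0. Qed.

Let sg0 : sg != 0. Proof. exact: contact_sg Cf. Qed.
Let ksg : k ^+ 2 + sg ^+ 2 = 1. Proof. exact: contact_ksg Cf. Qed.

Lemma ip_X_tangent w : W w -> ip (X w) (e1 w) = 0 /\ ip (X w) (e2 w) = 0.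
Proof.
move=> Ww; have [V1 V2] := vder_X Fr Ww.
rewrite -V1 -V2 !(ipC (X w)).
by split; apply: (vder_ip_unit Fr _ Ww (dX Ww)) => x; exact: contact_sphere Cf x.
Qed.

Lemma e2_decomp w : W w ->
  e2 w = sc (c w) (mI (X w)) + sc (s w * k) (mI (e1 w)) + sc (s w * sg) (n w).
Proof.
move=> Ww; have s0 := csin_neq0 Ww.
rewrite third.unlock scA divff ?mulf_neq0 // sc1 !scN -opprD addrC.
by rewrite addrNK.
Qed.

Lemma ip_e2 w : W w -> [/\ ip (e2 w) (X w) = 0, ip (e2 w) (mI (X w)) = c w,
  ip (e2 w) (e1 w) = 0, ip (e2 w) (mI (e1 w)) = s w * k & ip (e2 w) (e2 w) = 1].
Proof.
move=> Ww; split.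
- by rewrite ipC; have [] := ip_X_tangent Ww.
- by rewrite ipC.
- by rewrite ipC; exact: frame_12 Fr _ Ww.
- by rewrite ipC; exact: contact_kaehler Cf _ Ww.
- exact: frame_22 Fr _ Ww.
Qed.

Lemma ip_mI_e1 w : W w -> ip (X w) (mI (e1 w)) = 0 /\ ip (e1 w) (mI (X w)) = 0.
Proof.
move=> Ww; have E := contact_e1 Cf Ww.
by split; [apply/eqP; rewrite -oppr_eq0 -ip_mIl E|rewrite ipC].
Qed.

Lemma third_ip w v : W w -> ip v (n w) =
  (s w * sg)^-1 * (ip v (e2 w) - c w * ip v (mI (X w)) - s w * k * ip v (mI (e1 w))).
Proof. by move=> Ww; rewrite third.unlock ipZr !ipDr !ipZr !mulNr addrA. Qed.

Lemma unitary w : W w -> unitary_triple (X w) (e1 w) (n w).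
Proof.
move=> Ww; have s0 := csin_neq0 Ww.
have XX := contact_sphere Cf Ww; have e11 := frame_11 Fr Ww.
have [e2X e2iX e21 e2i1 e22] := ip_e2 Ww.
have [Xe1 Xe2] := ip_X_tangent Ww; have [Xi1 e1iX] := ip_mI_e1 Ww.
have Xn : ip (X w) (n w) = 0 by rewrite third_ip // Xe2 ip_mI Xi1 !mulr0 !subr0 mulr0.
have e1n : ip (e1 w) (n w) = 0.
  by rewrite third_ip // (ipC _ (e2 w)) e21 e1iX ip_mI !mulr0 !subr0 mulr0.
have iXn : ip (mI (X w)) (n w) = 0.
  by rewrite third_ip // (ipC _ (e2 w)) e2iX !ip_mI2 XX Xe1 mulr1 mulr0 subrr subr0 mulr0.
have ie1n : ip (mI (e1 w)) (n w) = 0.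
  rewrite third_ip // (ipC _ (e2 w)) e2i1 !ip_mI2 e11 (ipC _ (X w)) Xe1 mulr1 mulr0.
  by rewrite subr0 subrr mulr0.
have nn : ip (n w) (n w) = 1.
  rewrite third_ip // (ipC _ (mI (X w))) iXn (ipC _ (mI (e1 w))) ie1n !mulr0 !subr0.
  rewrite ipC third_ip // e22 e2iX e2i1.
  have := csin2 Ww; move: (c w) (s w) s0 => x y y0 E.
  have -> : 1 - x * x - y * k * (y * k) = (y * sg) * (y * sg).
    have -> : (y * sg) * (y * sg) = y ^+ 2 * sg ^+ 2 by ring.
    by rewrite -[sg ^+ 2](addKr (k ^+ 2)) ksg -[X in X - _ - _]E; ring.
  by field; rewrite sg0.
split; first by split.
split; first by split.
split=> //.
  by apply/eqP; rewrite -oppr_eq0 -ip_mIl iXn.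
by apply/eqP; rewrite -oppr_eq0 -ip_mIl ie1n.
Qed.

Lemma third_diff w : W w -> diffC3 n w.
Proof.
move=> Ww; have dc := ccos_diff Ww; have ds := csin_diff Ww.
have dk (r : R) : differentiable (fun x => s x * r) w.
  by apply: diffMf => //; exact: differentiable_cst.
rewrite unlock; apply: diffC3Z; first by apply: diffVf => //; rewrite mulf_neq0 ?csin_neq0.
apply: diffC3D; first exact: de2.
apply: diffC3D; apply: diffC3Z.
- exact: diffNf.
- by apply: diffC3I; exact: dX.
- exact: diffNf.
- by apply: diffC3I; exact: de1.
Qed.

Lemma vderC3_e2 V w : W w ->
  vderC3 V e2 w =
    sc (vder V c w) (mI (X w)) + sc (c w) (mI (vderC3 V X w)) +
    (sc (vder V s w * k) (mI (e1 w)) + sc (s w * k) (mI (vderC3 V e1 w))) +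
    (sc (vder V s w * sg) (n w) + sc (s w * sg) (vderC3 V n w)).
Proof.
move=> Ww; have dc := ccos_diff Ww; have ds := csin_diff Ww.
have dk (r : R) : differentiable (fun x => s x * r) w.
  by apply: diffMf => //; exact: differentiable_cst.
have vk (r : R) : vder V (fun x => s x * r) w = vder V s w * r.
  by rewrite (vderM V ds (differentiable_cst r w)) vder_cst mulr0 addr0.
have E : \forall x \near w, e2 x =
    sc (c x) (mI (X x)) + sc (s x * k) (mI (e1 x)) + sc (s x * sg) (n x).
  by apply: filterS (near_in oW Ww) => x; exact: e2_decomp.
rewrite (near_eq_vderC3 V E).
have dn := third_diff Ww; have dIX := diffC3I (dX Ww); have dI1 := diffC3I (de1 Ww).
rewrite (vderC3D V (diffC3D (diffC3Z dc dIX) (diffC3Z (dk k) dI1)) (diffC3Z (dk sg) dn)).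
rewrite (vderC3D V (diffC3Z dc dIX) (diffC3Z (dk k) dI1)).
rewrite (vderC3Z V dc dIX) (vderC3Z V (dk k) dI1) (vderC3Z V (dk sg) dn) !vk.
by rewrite (vderC3I V (dX Ww)) (vderC3I V (de1 Ww)).
Qed.

(** The Maurer-Cartan form of the unitary frame has diagonal entries [i mu] and [i nu]
    at [e1] and [n], joined by the entry [tauRe + i tauIm]. *)
Definition mu V w : R := ip (vderC3 V e1 w) (mI (e1 w)).
Definition tauRe V w : R := ip (vderC3 V e1 w) (n w).
Definition tauIm V w : R := ip (vderC3 V e1 w) (mI (n w)).
Definition nu V w : R := ip (vderC3 V n w) (mI (n w)).

Lemma gram w : W w ->
  ((ip (X w) (X w) = 1) * (ip (X w) (mI (X w)) = 0) * (ip (X w) (e1 w) = 0) *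
   (ip (X w) (mI (e1 w)) = 0) * (ip (X w) (n w) = 0) * (ip (X w) (mI (n w)) = 0)) *
  ((ip (e1 w) (X w) = 0) * (ip (e1 w) (mI (X w)) = 0) * (ip (e1 w) (e1 w) = 1) *
   (ip (e1 w) (mI (e1 w)) = 0) * (ip (e1 w) (n w) = 0) * (ip (e1 w) (mI (n w)) = 0)) *
  ((ip (n w) (X w) = 0) * (ip (n w) (mI (X w)) = 0) * (ip (n w) (e1 w) = 0) *
   (ip (n w) (mI (e1 w)) = 0) * (ip (n w) (n w) = 1) * (ip (n w) (mI (n w)) = 0)).
Proof.
move=> /unitary[[XX e11 nn] [[Xe1 Xn e1n] [Xi1 Xin e1in]]].
have sw (u v : 'C3[R]) : ip u (mI v) = 0 -> ip v (mI u) = 0.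
  by move=> E; rewrite ipC ip_mIl E oppr0.
have [[i1X inX] in1] := (sw _ _ Xi1, sw _ _ Xin, sw _ _ e1in).
by do !split => //; rewrite ?ip_mI // ipC.
Qed.

Lemma ip_D_e1 V w (v : 'C3[R]) : W w -> vderC3 V X w = v ->
  (ip (vderC3 V e1 w) (X w) = - ip (e1 w) v) *
  (ip (vderC3 V e1 w) (mI (X w)) = - ip (e1 w) (mI v)) *
  (ip (vderC3 V e1 w) (e1 w) = 0).
Proof.
move=> Ww <-; split; [split|].
- by apply: (vder_cst_ip Fr V Ww (de1 Ww) (dX Ww) (r := 0)) => x /gram ->.
- rewrite -(vderC3I V (dX Ww)).
  by apply: (vder_cst_ip Fr V Ww (de1 Ww) (diffC3I (dX Ww)) (r := 0)) => x /gram ->.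
- by apply: (vder_ip_unit Fr V Ww (de1 Ww)) => x /gram ->.
Qed.

Lemma ip_D_n V w (v : 'C3[R]) : W w -> vderC3 V X w = v ->
  (ip (vderC3 V n w) (X w) = - ip (n w) v) *
  (ip (vderC3 V n w) (mI (X w)) = - ip (n w) (mI v)) *
  (ip (vderC3 V n w) (e1 w) = - tauRe V w) *
  (ip (vderC3 V n w) (mI (e1 w)) = tauIm V w) *
  (ip (vderC3 V n w) (n w) = 0).
Proof.
move=> Ww <-; have dn := third_diff Ww; split; [split; [split; [split|]|]|].
- by apply: (vder_cst_ip Fr V Ww dn (dX Ww) (r := 0)) => x /gram ->.
- rewrite -(vderC3I V (dX Ww)).
  by apply: (vder_cst_ip Fr V Ww dn (diffC3I (dX Ww)) (r := 0)) => x /gram ->.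
- rewrite /tauRe (ipC _ (n w)).
  by apply: (vder_cst_ip Fr V Ww dn (de1 Ww) (r := 0)) => x /gram ->.
- rewrite /tauIm -[RHS]opprK -ip_mIl (ipC _ (n w)) -(vderC3I V (de1 Ww)).
  by apply: (vder_cst_ip Fr V Ww dn (diffC3I (de1 Ww)) (r := 0)) => x /gram ->.
- by apply: (vder_ip_unit Fr V Ww dn) => x /gram ->.
Qed.

Lemma gram_e2 w : W w ->
  (ip (e2 w) (X w) = 0) * (ip (e2 w) (mI (X w)) = c w) * (ip (e2 w) (e1 w) = 0) *
  (ip (e2 w) (mI (e1 w)) = s w * k) * (ip (e2 w) (n w) = s w * sg) *
  (ip (e2 w) (mI (n w)) = 0).
Proof.
move=> Ww; rewrite e2_decomp // !(ipDl, ipZl, ip_mIl, mI_mI, ipNr) !(gram Ww).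
by do !split; ring.
Qed.

Local Notation E1 := (E1 X e1 e2).
Local Notation E2 := (E2 X e1 e2).

Lemma ip_D w : W w ->
  ((ip (D1 e1 w) (X w) = -1) * (ip (D1 e1 w) (mI (X w)) = 0) * (ip (D1 e1 w) (e1 w) = 0) *
   (ip (D2 e1 w) (X w) = 0) * (ip (D2 e1 w) (mI (X w)) = s w * k) *
   (ip (D2 e1 w) (e1 w) = 0)) *
  ((ip (D1 n w) (X w) = 0) * (ip (D1 n w) (mI (X w)) = 0) *
   (ip (D1 n w) (e1 w) = - tauRe E1 w) * (ip (D1 n w) (mI (e1 w)) = tauIm E1 w) *
   (ip (D1 n w) (n w) = 0)) *
  ((ip (D2 n w) (X w) = - (s w * sg)) * (ip (D2 n w) (mI (X w)) = 0) *
   (ip (D2 n w) (e1 w) = - tauRe E2 w) * (ip (D2 n w) (mI (e1 w)) = tauIm E2 w) *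
   (ip (D2 n w) (n w) = 0)).
Proof.
move=> Ww; have [V1 V2] := vder_X Fr Ww.
rewrite !(ip_D_e1 Ww V1, ip_D_e1 Ww V2, ip_D_n Ww V1, ip_D_n Ww V2).
have sw (u v : 'C3[R]) : ip u (mI v) = - ip v (mI u) by rewrite ipC ip_mIl.
rewrite (sw (e1 w) (e2 w)) (sw (n w) (e2 w)) (ipC (e1 w) (e2 w)) (ipC (n w) (e2 w)).
by rewrite !(gram_e2 Ww) !(gram Ww) !oppr0 opprK.
Qed.

(** The three groups express that the surface is torsion free, minimal, and that
    [theta_1^3 = a theta^1]. For the second one, minimality is tested against four
    vectors spanning the normal space. *)
Lemma first_order_raw w : W w ->
  [/\ d1 c w - 2 * s w * k = - (w2 w * c w),
      c w + k * d1 s w + s w * sg * tauIm E1 w - mu E2 w = - (w2 w * (s w * k)),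
      sg * d1 s w - s w * k * tauIm E1 w - tauRe E2 w = - (w2 w * (s w * sg)) &
      s w * k * tauRe E1 w + s w * sg * nu E1 w - tauIm E2 w = 0] /\
  [/\ tauIm E1 w + c w * (s w * sg) + s w * k * tauRe E2 w + s w * sg * nu E2 w = 0,
      s w * k * d2 c w = c w * (mu E1 w + k * d2 s w + s w * sg * tauIm E2 w),
      sg * (mu E1 w + k * d2 s w + s w * sg * tauIm E2 w) =
        k * (tauRe E1 w + sg * d2 s w - s w * k * tauIm E2 w) &
      s w * sg * d2 c w = c w * (tauRe E1 w + sg * d2 s w - s w * k * tauIm E2 w)] /\
  [/\ sg * mu E1 w - k * tauRe E1 w = a, sg * mu E2 w - k * tauRe E2 w = 0,
      w1 w = s w * k * mu E1 w + s w * sg * tauRe E1 w &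
      w2 w = c w * (s w * k) + s w * k * mu E2 w + s w * sg * tauRe E2 w].
Proof.
move=> Ww; have [V1 V2] := vder_X Fr Ww.
have [T _] := torsion_free Fr Ww.
have TT f := congr1 (fun v => ip v f) T.
have gather : forall V, (ip (vderC3 V e1 w) (mI (e1 w)) = mu V w) *
  (ip (vderC3 V e1 w) (n w) = tauRe V w) * (ip (vderC3 V e1 w) (mI (n w)) = tauIm V w) *
  (ip (vderC3 V n w) (mI (n w)) = nu V w) by [].
have W1E : w1 w = s w * k * mu E1 w + s w * sg * tauRe E1 w.
  rewrite /omega1 e2_decomp // !ipDr !ipZr !(ip_D Ww) !gather.
  by move: (c w) (s w) (mu E1 w) (tauRe E1 w) => *; ring.
have W2E : w2 w = c w * (s w * k) + s w * k * mu E2 w + s w * sg * tauRe E2 w.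
  by rewrite /omega2 e2_decomp // !ipDr !ipZr !(ip_D Ww) !gather.
split; [|split].
- have := (TT (mI (X w)), TT (mI (e1 w)), TT (n w), TT (mI (n w))).
  rewrite (vderC3_e2 E1 Ww) V1.
  rewrite !(ipDl, ipZl, ipNl) !(ip_mIl, mI_mI, ipNr) !(gram_e2 Ww) !(gram Ww) !(ip_D Ww).
  rewrite !gather.
  move: (d1 c w) (d1 s w) (mu E1 w) (mu E2 w) (tauRe E1 w) (tauRe E2 w) (tauIm E1 w)
    (tauIm E2 w) (nu E1 w) (w1 w) (w2 w) (c w) (s w) => dc ds m1 m2 r1 r2 i1 i2 n1 o1 o2 x y.
  by move=> [[[h0 h1] h2] h3]; clear -h0 h1 h2 h3; split; lra.
- have Min m := @contact_minimal _ _ Cf w m Ww.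
  have Y (f g : 'C3[R]) (x y : R) (h : 'C3[R]) : ip h (sc x f + sc y g) = x * ip h f + y * ip h g.
    by rewrite ipDr !ipZr.
  have := (Min (mI (n w)), Min (sc (s w * k) (mI (X w)) + sc (- c w) (mI (e1 w))),
    Min (sc sg (mI (e1 w)) + sc (- k) (n w)),
    Min (sc (s w * sg) (mI (X w)) + sc (- c w) (n w))).
  rewrite !Y (vderC3_e2 E2 Ww) V2.
  rewrite !(ipDl, ipZl, ipNl) !(ip_mIl, mI_mI, ipNr) !(gram_e2 Ww) !(gram Ww) !(ip_D Ww).
  rewrite !gather.
  move: (d2 c w) (d2 s w) (mu E1 w) (mu E2 w) (tauRe E1 w) (tauRe E2 w) (tauIm E1 w)
    (tauIm E2 w) (nu E2 w) (w1 w) (w2 w) (c w) (s w) => dc ds m1 m2 r1 r2 i1 i2 n2 o1 o2 x y.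
  have z0 (p q : R) : p * 0 + q * 0 = 0 by rewrite !mulr0 addr0.
  have z1 : y * k * x + - x * (y * k) = 0 by ring.
  have z2 : sg * (y * k) + - k * (y * sg) = 0 by ring.
  have z3 : y * sg * x + - x * (y * sg) = 0 by ring.
  move=> [[[/(_ erefl erefl erefl) h0 /(_ (z0 _ _) (z0 _ _) z1) h1]
    /(_ (z0 _ _) (z0 _ _) z2) h2] /(_ (z0 _ _) (z0 _ _) z3) h3].
  by clear -h0 h1 h2 h3; split; lra.
- split=> //.
  + rewrite -(contact_e3_1 Cf Ww) ipDr !ipZr !gather.
    by move: (mu E1 w) (tauRe E1 w) => *; ring.
  + rewrite -(contact_e3_2 Cf Ww) ipDr !ipZr !gather.
    by move: (mu E2 w) (tauRe E2 w) => *; ring.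
Qed.

(** The first structure equations: minimality, constancy of [k] and the shape of
    the second fundamental form in the direction [e3] leave only the connection
    form of the surface undetermined. *)
Lemma first_order w : W w ->
  [/\ d1 c w = 2 * s w * k - c w * w2 w, d2 c w = c w * w1 w,
      tauIm E1 w = - (sg * c w / s w) & tauIm E2 w = - (a / s w)] /\
  [/\ mu E1 w = k * (w1 w / s w) + sg * a, mu E2 w = k * (w2 w / s w - k * c w),
      tauRe E1 w = sg * (w1 w / s w) - k * a & tauRe E2 w = sg * (w2 w / s w - k * c w)] /\
  sg * nu E1 w = - (a / s w ^+ 2) - k * tauRe E1 w /\
  nu E2 w = c w / s w ^+ 2 - c w - k * (w2 w / s w - k * c w).
Proof.
move=> Ww; have [[t0 t1 t2 t3] [[m0 m1 m2 m3] [h1 h2 W1E W2E]]] := first_order_raw Ww.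
have s0 := csin_neq0 Ww; have cs := csin2 Ww; have csd2 := csin_vder E2 Ww.
move: s0 cs csd2 t0 t1 t2 t3 m0 m1 m2 m3 h1 h2 W1E W2E.
move: (d1 c w) (d1 s w) (d2 c w) (d2 s w) (mu E1 w) (mu E2 w) (tauRe E1 w) (tauRe E2 w)
  (tauIm E1 w) (tauIm E2 w) (nu E1 w) (nu E2 w) (w1 w) (w2 w) (c w) (s w).
move: sg0 ksg; clear.
move=> sg0 ksg c1 s1 c2 s2 m1 m2 r1 r2 i1 i2 n1 n2 o1 o2 c s s0 cs csd t0 t1 t2 t3.
move=> M0 M1 M2 M3 h1 h2 O1 O2.
have K x : k ^+ 2 * x + sg ^+ 2 * x = x by rewrite -mulrDl ksg mul1r.
have [I1 I2] : s * i1 = - (sg * c) /\ s * i2 = - a.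
  have := (K (s * i1), K (s * i2)) => -[K1 K2]; split; last by lra.
  have : sg * (c + k * s1 + s * sg * i1 - m2) - k * (sg * s1 - s * k * i1 - r2) =
         sg * - (o2 * (s * k)) - k * - (o2 * (s * sg)) by rewrite t1 t2.
  by lra.
have A1 : k * m1 + sg * r1 = o1 / s by apply: (mulIf s0); rewrite divfK //; lra.
have A2 : k * m2 + sg * r2 = o2 / s - k * c.
  by apply: (mulIf s0); rewrite mulrBl divfK //; lra.
have E1 : i1 = - (sg * c / s) by apply: (mulfI s0); rewrite I1; field.
have E2 : i2 = - (a / s) by apply: (mulfI s0); rewrite I2; field.
have R1 : r1 = sg * (o1 / s) - k * a by rewrite -A1 -h1; have := K r1; lra.
have R2 : r2 = sg * (o2 / s - k * c).
  have Z : k * (sg * m2 - k * r2) = 0 by rewrite h2 mulr0.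
  by rewrite -A2; have := K r2; lra.
have U1 : m1 = k * (o1 / s) + sg * a by rewrite -A1 -h1; have := K m1; lra.
have U2 : m2 = k * (o2 / s - k * c).
  have Z : sg * (sg * m2 - k * r2) = 0 by rewrite h2 mulr0.
  by rewrite -A2; have := K m2; lra.
have C2 : c2 = c * o1.
  have Q : s * k * (s * k * c2) + s * sg * (s * sg * c2) =
     c * (o1 + s * s2 * (k ^+ 2 + sg ^+ 2)).
    by rewrite M1 M3 O1; ring.
  have := K (s ^+ 2 * c2); move: Q; rewrite ksg mulr1.
  have : (c ^+ 2 + s ^+ 2) * c2 = c2 by rewrite cs mul1r.
  have : c * (c * c2 + s * s2) = 0 by rewrite csd mulr0.
  by lra.
split; [split=> //; lra|split; [by split|split]].
  apply: (mulfI s0).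
  have -> : s * (- (a / s ^+ 2) - k * r1) = - (a / s) - s * k * r1 by field.
  by rewrite -E2; lra.
apply: (mulfI s0); apply: (mulfI sg0).
have -> : sg * (s * n2) = - (i1 + c * (s * sg) + s * k * r2) by lra.
by rewrite E1 R2; field.
Qed.

(** The component along [m] of the equation [d (d e1) = 0]. *)
Lemma codazzi w (m : 'rV[R]_2 -> 'C3[R]) : W w -> diffC3 m w ->
  d1 (fun x => ip (D2 e1 x) (m x)) w - d2 (fun x => ip (D1 e1 x) (m x)) w =
  ip (D2 e1 w) (D1 m w) - ip (D1 e1 w) (D2 m w)
  - (w1 w * ip (D1 e1 w) (m w) + w2 w * ip (D2 e1 w) (m w)).
Proof.
move=> Ww dm; have se1 := frame_e1 Fr.
have dD1 := vderC3_diff (fun j => E1_diff Fr j Ww) Ww se1.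
have dD2 := vderC3_diff (fun j => E2_diff Fr j Ww) Ww se1.
have := congr1 (fun v => ip v (m w)) (bracketC3 Fr Ww se1).
rewrite ipDl !ipNl ipDl !ipZl (vder_ip _ dD2 dm) (vder_ip _ dD1 dm).
move: (ip _ _) (ip _ _) (ip _ _) (ip _ _) (ip _ _) (ip _ _) => x1 x2 x3 x4 x5 x6.
by lra.
Qed.

Let gather V w : (ip (vderC3 V e1 w) (mI (e1 w)) = mu V w) *
  (ip (vderC3 V e1 w) (n w) = tauRe V w) * (ip (vderC3 V e1 w) (mI (n w)) = tauIm V w) *
  (ip (vderC3 V n w) (mI (n w)) = nu V w).
Proof. by []. Qed.

Lemma ip_D12 w : W w ->
  (ip (D2 e1 w) (D1 n w) = mu E2 w * tauIm E1 w + tauIm E2 w * nu E1 w) *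
  (ip (D1 e1 w) (D2 n w) = s w * sg + mu E1 w * tauIm E2 w + tauIm E1 w * nu E2 w) *
  (ip (D2 e1 w) (mI (D1 e1 w)) =
     - (s w * k) + tauIm E2 w * tauRe E1 w - tauRe E2 w * tauIm E1 w) *
  (ip (D2 e1 w) (mI (D1 n w)) =
     - mu E2 w * tauRe E1 w - tauRe E2 w * nu E1 w) *
  (ip (D1 e1 w) (mI (D2 n w)) =
     - mu E1 w * tauRe E2 w - tauRe E1 w * nu E2 w).
Proof.
move=> Ww; have Pa z v := parseval z v (unitary Ww).
rewrite (Pa (D2 e1 w) (D1 n w)) (Pa (D1 e1 w) (D2 n w)) (Pa (D2 e1 w) (mI (D1 e1 w)))
  (Pa (D2 e1 w) (mI (D1 n w))) (Pa (D1 e1 w) (mI (D2 n w))).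
rewrite !(ip_mIl, mI_mI, ipNr) !(ip_D Ww) !gather.
move: (mu E1 w) (mu E2 w) (tauRe E1 w) (tauRe E2 w) (tauIm E1 w) (tauIm E2 w)
  (nu E1 w) (nu E2 w) (s w) => *; do !split; ring.
Qed.

(** Codazzi equation in the direction [e3]; as [theta_1^3 = a theta^1] has
    constant coefficients, no derivative is left. *)
Lemma codazzi_e3 w : W w ->
  - (a * w1 w * (2 + s w ^+ 2) / s w) + 2 * sg * w2 w * c w / s w
  - sg * k / s w ^+ 2 - a ^+ 2 * k / sg * c w ^+ 2 / s w ^+ 2 = 0.
Proof.
move=> Ww; have dn := third_diff Ww; have dI1 := diffC3I (de1 Ww).
have dk r : differentiable (fun _ : 'rV[R]_2 => r : R) w by exact: differentiable_cst.
pose m x := sc sg (mI (e1 x)) + sc (- k) (n x).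
have dm : diffC3 m w by exact: diffC3D (diffC3Z (dk sg) dI1) (diffC3Z (dk (- k)) dn).
have Dm V : vderC3 V m w = sc sg (mI (vderC3 V e1 w)) + sc (- k) (vderC3 V n w).
  rewrite /m (vderC3D V (diffC3Z (dk sg) dI1) (diffC3Z (dk (- k)) dn)).
  rewrite (vderC3Z V (dk sg) dI1) (vderC3Z V (dk (- k)) dn) !vder_cst !sc0 !add0r.
  by rewrite (vderC3I V (de1 Ww)).
have m1 x : W x -> ip (D1 e1 x) (m x) = a by exact: contact_e3_1 Cf x.
have m2 x : W x -> ip (D2 e1 x) (m x) = 0 by exact: contact_e3_2 Cf x.
have := codazzi Ww dm.
rewrite (near_eq_vder _ (filterS m2 (near_in oW Ww))).
rewrite (near_eq_vder _ (filterS m1 (near_in oW Ww))) !vder_cst m1 // m2 //.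
rewrite !Dm !ipDr !ipZr (ipC (D1 e1 w) (mI (D2 e1 w))) ip_mIl !(ip_D12 Ww).
have [[_ _ -> ->] [[-> -> R1 ->] [n1 ->]]] := first_order Ww.
move: n1; rewrite R1; have := csin2 Ww; have := csin_neq0 Ww.
move: (w1 w) (w2 w) (c w) (s w) (nu E1 w) => o1 o2 x y n1 y0 E n1E.
have -> : n1 = (- (a / y ^+ 2) - k * (sg * (o1 / y) - k * a)) / sg.
  by rewrite -n1E mulrC mulKf.
set rhs := RHS => H.
(* the two sides differ by multiples of the relations between cosines and sines *)
transitivity (y * rhs
    + ((k ^+ 2 + sg ^+ 2 - 1) *
         (2 * sg * a * (o1 / y) - k * a ^+ 2 - 2 * sg ^+ 2 * x * (o2 / y - k * x))
       + (x ^+ 2 + y ^+ 2 - 1) *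
         (k * sg ^+ 2 * (1 + (y ^+ 2)^-1) - k * a ^+ 2 / y ^+ 2)) / sg).
  by rewrite /rhs; field; rewrite y0 sg0.
by rewrite -H ksg E !subrr !mul0r mulr0 addr0 mul0r addr0.
Qed.

(** Codazzi equation in the direction [i n]. The components of [theta_1^k] involved
    depend on [a] and on the contact angle only, and their derivatives, given by
    [first_order], combine to [3 a omega2 = 0]. *)
Lemma codazzi_in w : W w -> a * w2 w = 0.
Proof.
move=> Ww; have dn := third_diff Ww; have ds := csin_diff Ww; have s0 := csin_neq0 Ww.
have dc := ccos_diff Ww.
have ev V (f : 'rV[R]_2 -> R) (r : R) : differentiable f w -> (forall x, W x -> f x * s x = r) ->
   s w * vder V f w = - f w * vder V s w.
  move=> df fE; have := vderM V df ds.
  rewrite (near_eq_vder _ (filterS fE (near_in oW Ww))) vder_cst.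
  by move: (vder V f w) (vder V s w) => x y; lra.
have dI := diffC3I dn.
have dD1 := vderC3_diff (fun j => E1_diff Fr j Ww) Ww (frame_e1 Fr).
have dD2 := vderC3_diff (fun j => E2_diff Fr j Ww) Ww (frame_e1 Fr).
have F1 : s w * d1 (fun x => ip (D2 e1 x) (mI (n x))) w = - tauIm E2 w * d1 s w.
  apply: (ev _ _ (- a)); first exact: diff_ip.
  move=> x Wx; have [[_ _ _ I2] _] := first_order Wx.
  by rewrite gather I2 -mulNr divfK // csin_neq0.
have F2 : s w * d2 (fun x => ip (D1 e1 x) (mI (n x))) w =
    - tauIm E1 w * d2 s w - sg * d2 c w.
  have df := diff_ip dD1 dI.
  have := vderM E2 df ds.
  have E : \forall x \near w, ip (D1 e1 x) (mI (n x)) * s x = - sg * c x.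
    apply: filterS (near_in oW Ww) => x Wx; have [[_ _ I1 _] _] := first_order Wx.
    by rewrite gather I1 mulNr divfK ?csin_neq0 // mulNr.
  rewrite (near_eq_vder _ E) (vderM _ (differentiable_cst (- sg) w) dc) vder_cst gather.
  move: (d2 (fun x => _) w) (d2 s w) (d2 c w) (tauIm E1 w) (s w) (c w) => x y z t p q.
  by rewrite /cst; lra.
have := codazzi Ww dI; rewrite (vderC3I E1 dn) (vderC3I E2 dn) !gather !(ip_D12 Ww).
move/(congr1 ( *%R (s w))); rewrite mulrBr F1 F2.
have := csin_vder E1 Ww; have := csin_vder E2 Ww.
have [[-> -> -> ->] [[-> -> R1 ->] [n1 ->]]] := first_order Ww.
move: n1; rewrite R1; have := csin2 Ww; move: s0.
move: (d1 s w) (d2 s w) (w1 w) (w2 w) (c w) (s w) (nu E1 w).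
move=> s1 s2 o1 o2 x y n1 y0 E n1E S2 S1.
have -> : n1 = (- (a / y ^+ 2) - k * (sg * (o1 / y) - k * a)) / sg.
  by rewrite -n1E mulrC mulKf.
have cancel z t : x * z + y * t = 0 -> t = - (x * z / y).
  by move=> H; apply: (mulfI y0); rewrite mulrN [y * (_ / y)]mulrC divfK //; lra.
rewrite (cancel _ _ S1) (cancel _ _ S2).
move/eqP; rewrite -subr_eq0 => /eqP; set lhs := LHS => H.
have : lhs = - (3 * (a * o2))
    + (x ^+ 2 + y ^+ 2 - 1) * (sg * x * (o1 / y) + a * (o2 / y)) / y
    - (k ^+ 2 + sg ^+ 2 - 1) * (a * y * (o2 / y - k * x)).
  by rewrite /lhs; field; rewrite y0 sg0.
by rewrite H ksg E !subrr !mul0r addr0 subr0 => H1; lra.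
Qed.

End structure.
End contact.

(** * The case of a right holomorphic angle and a = 0 *)

Section lagrangian.
Variables (R : realType) (X e1 e2 : 'rV[R]_2 -> 'C3[R]) (k sg a : R) (W : set 'rV[R]_2).
Hypothesis Cf : contact_frame X e1 e2 k sg W a.
Local Notation E1 := (E1 X e1 e2).
Local Notation E2 := (E2 X e1 e2).
Local Notation D1 := (vderC3 E1).
Local Notation D2 := (vderC3 E2).
Local Notation d1 := (vder E1).
Local Notation d2 := (vder E2).
Local Notation w1 := (omega1 X e1 e2).
Local Notation w2 := (omega2 X e1 e2).
Local Notation c := (ccos X e2).
Local Notation s := (csin X e2).
Local Notation n := (third X e1 e2 k sg).
Local Notation tauRe := (tauRe X e1 e2 k sg).

Let Fr : orthonormal_frame W X e1 e2. Proof. by case: Cf. Qed.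
Let oW : open W. Proof. exact: frame_open Fr. Qed.

(** The contact angle is a function, so that [d (d c) = 0]. *)
Lemma bracket_ccos w : W w ->
  d1 (d2 c) w - d2 (d1 c) w = - (w1 w * d1 c w + w2 w * d2 c w).
Proof.
move=> Ww; have sX := frame_X Fr; have se2 := frame_e2 Fr.
have dE1 j := E1_diff Fr j Ww; have dE2 j := E2_diff Fr j Ww.
have dc V x : W x -> vder V c x =
    ip (mI (vderC3 V X x)) (e2 x) + ip (mI (X x)) (vderC3 V e2 x).
  move=> Wx; have dX := smoothC3_diff sX Wx.
  by rewrite (vder_ip V (diffC3I dX) (smoothC3_diff se2 Wx)) (vderC3I V dX).
have dX := smoothC3_diff sX Ww; have de2 := smoothC3_diff se2 Ww.
have ddc U V : (forall j, differentiable (V j) w) -> vder U (vder V c) w =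
    ip (mI (vderC3 U (vderC3 V X) w)) (e2 w) + ip (mI (vderC3 V X w)) (vderC3 U e2 w) +
    (ip (mI (vderC3 U X w)) (vderC3 V e2 w) + ip (mI (X w)) (vderC3 U (vderC3 V e2) w)).
  move=> dV; rewrite (near_eq_vder U (filterS (@dc V) (near_in oW Ww))).
  have dVX := vderC3_diff dV Ww sX; have dVe := vderC3_diff dV Ww se2.
  rewrite (vderD U (diff_ip (diffC3I dVX) de2) (diff_ip (diffC3I dX) dVe)).
  rewrite (vder_ip U (diffC3I dVX) de2) (vder_ip U (diffC3I dX) dVe).
  by rewrite (vderC3I U dVX) (vderC3I U dX).
have BX := congr1 (fun v => ip (mI v) (e2 w)) (bracketC3 Fr Ww sX).
have Be := congr1 (fun v => ip (mI (X w)) v) (bracketC3 Fr Ww se2).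
rewrite (ddc _ _ dE2) (ddc _ _ dE1) !dc //.
move: BX Be; rewrite !(mID, mIN, mIZ) !(ipDl, ipDr, ipNl, ipNr, ipZl, ipZr).
move: (ip (mI (D1 (D2 X) w)) (e2 w)) (ip (mI (D2 (D1 X) w)) (e2 w))
 (ip (mI (X w)) (D1 (D2 e2) w)) (ip (mI (X w)) (D2 (D1 e2) w)) => x1 x2 x3 x4.
move: (ip (mI (D1 X w)) (e2 w)) (ip (mI (D2 X w)) (e2 w)) (ip (mI (X w)) (D1 e2 w))
  (ip (mI (X w)) (D2 e2 w)) (ip _ _) (ip _ _) (w1 w) (w2 w) => *.
by lra.
Qed.

Hypotheses (k0 : k = 0) (a0 : a = 0).

Lemma ccos_omega2 w : W w -> c w * w2 w = 0.
Proof.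
move=> Ww; have := codazzi_e3 Cf Ww; have s0 := csin_neq0 Cf Ww.
have sg0 := contact_sg Cf; rewrite k0 a0.
move: (w1 w) (w2 w) (c w) (s w) s0 => o1 o2 x y y0.
move=> H; have z0 : 2 * sg / y != 0 by rewrite !mulf_neq0 ?invr_eq0 ?pnatr_eq0.
by apply: (mulfI z0); rewrite mulr0 -[RHS]H; field; rewrite ?y0 ?sg0.
Qed.

Lemma vder_ccos w : W w -> d1 c w = 0 /\ d2 c w = c w * w1 w.
Proof.
move=> Ww; have [[-> -> _ _] _] := first_order Cf Ww.
by rewrite ccos_omega2 // k0 mulr0 subr0.
Qed.

Lemma near_ccos_neq0 w : W w -> c w != 0 -> \forall x \near w, W x /\ c x != 0.
Proof.
move=> Ww c0; have dc := ccos_diff Cf Ww.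
have cc : {for w, continuous c} by exact: differentiable_continuous.
have nz : \forall x \near w, c x != 0 by exact: cvgr_neq0 cc c0.
by near=> x; split; near: x => //; exact: near_in.
Unshelve. all: by end_near.
Qed.

(** The derivative along [E1] vanishes by [bracket_ccos]; that along [E2] is given by
    the Codazzi equation in the direction [n], the one equation that differentiates
    the connection form. *)
Lemma vder_omega1 w : W w -> c w != 0 ->
  d1 w1 w = 0 /\ s w ^+ 2 * d2 w1 w = (s w ^+ 2 - c w ^+ 2) * (1 + w1 w ^+ 2).
Proof.
move=> Ww c0; have s0 := csin_neq0 Cf Ww; have sg0 := contact_sg Cf.
have dc := ccos_diff Cf Ww; have ds := csin_diff Cf Ww; have dn := third_diff Cf Ww.
have nc0 := near_ccos_neq0 Ww c0.
have nW : \forall x \near w, W x by exact: near_in.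
have w20 x : W x -> c x != 0 -> w2 x = 0.
  by move=> Wx x0; apply: (mulfI x0); rewrite ccos_omega2 // mulr0.
have dD1 := vderC3_diff (fun j => E1_diff Fr j Ww) Ww (frame_e1 Fr).
have dw1 : differentiable w1 w by apply: diff_ip => //; exact: smoothC3_diff (frame_e2 Fr) Ww.
split.
  have := bracket_ccos Ww; have [-> ->] := vder_ccos Ww; rewrite (w20 _ Ww c0).
  have E1c : \forall x \near w, d1 c x = 0.
    by apply: filterS nW => x /vder_ccos[].
  have E2c : \forall x \near w, d2 c x = c x * w1 x.
    by apply: filterS nW => x /vder_ccos[].
  rewrite (near_eq_vder _ E1c) (near_eq_vder _ E2c) vder_cst (vderM _ dc dw1).
  have [-> _] := vder_ccos Ww; rewrite !(mulr0, mul0r, add0r, subr0, oppr0).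
  by move/eqP; rewrite mulf_eq0 (negPf c0) => /eqP.
have := codazzi Cf Ww dn.
have Z2 : \forall x \near w, ip (D2 e1 x) (n x) = 0.
  apply: filterS nc0 => x [Wx x0]; have [_ [[_ _ _ P2] _]] := first_order Cf Wx.
  by rewrite -/(tauRe E2 x) P2 w20 // k0 mul0r mul0r subr0 mulr0.
have Z1 : \forall x \near w, ip (D1 e1 x) (n x) * s x = sg * w1 x.
  apply: filterS nW => x Wx; have [_ [[_ _ P1 _] _]] := first_order Cf Wx.
  by rewrite -/(tauRe E1 x) P1 k0 mul0r subr0 -mulrA divfK // (csin_neq0 Cf).
rewrite (near_eq_vder _ Z2) vder_cst.
have dip := diff_ip dD1 dn.
have := vderM E2 dip ds; rewrite (near_eq_vder _ Z1).
rewrite (vderM _ (differentiable_cst sg w) dw1) vder_cst /cst.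
rewrite !(ip_D12 Cf Ww) -/(tauRe E1 w) -/(tauRe E2 w).
have [[_ C2 -> ->] [[-> -> -> ->] [n1 ->]]] := first_order Cf Ww.
have := csin_vder Cf E2 Ww; have := csin2 Cf Ww; rewrite C2 (w20 _ Ww c0) k0 a0.
move: (d2 (fun x => _) w) (d2 s w) (d2 w1 w) (c w) (s w) (w1 w) s0 {n1 C2}.
move=> t s2 o x y o1 y0 E S H1 H2.
have tE : t = sg * (y - x ^+ 2 / y ^+ 3 + x ^+ 2 / y + o1 ^+ 2 / y).
  by rewrite -[t]opprK -[- t]sub0r H2; field.
have s2E : s2 = - (x ^+ 2 * o1 / y).
  by apply: (mulfI y0); transitivity (- (x * (x * o1))); [lra|field].
have oE : o = y * (y - x ^+ 2 / y ^+ 3 + x ^+ 2 / y + o1 ^+ 2 / y) + o1 / y * s2.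
  apply: (mulfI sg0); transitivity (0 * o1 + sg * o); first by ring.
  by rewrite H1 tE; ring.
rewrite oE s2E; transitivity ((y ^+ 2 - x ^+ 2) * (1 + o1 ^+ 2)
  + y ^+ 2 * (x ^+ 2 + y ^+ 2 - 1)); first by field.
by rewrite E subrr mulr0 addr0.
Qed.

(** [(1 + omega1 ^ 2) / (sin beta * cos beta) ^ 2] is a first integral of the
    ordinary differential equation that [vder_ccos] and [vder_omega1] form along the
    integral curves of the second dual field. *)
Lemma first_integral w : W w -> c w != 0 ->
  \forall x \near w, (1 + w1 x ^+ 2) * ((1 - c w ^+ 2) * c w ^+ 2) =
                     (1 + w1 w ^+ 2) * ((1 - c x ^+ 2) * c x ^+ 2).
Proof.
move=> Ww c0.
pose N x := 1 + w1 x * w1 x; pose Q x := (1 + - (c x * c x)) * (c x * c x).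
pose g x := N x * (Q x)^-1.
have Q0 x : W x -> c x != 0 -> Q x != 0.
  move=> Wx x0; rewrite /Q mulf_neq0 ?mulf_neq0 // -expr2.
  by apply: lt0r_neq0; rewrite subr_gt0 (contact_lt1 Cf Wx).
have flat x : W x /\ c x != 0 ->
    differentiable g x /\ forall l, pd l g x = 0.
  move=> [Wx x0]; have dc := ccos_diff Cf Wx; have s0 := csin_neq0 Cf Wx.
  have dD1 := vderC3_diff (fun j => E1_diff Fr j Wx) Wx (frame_e1 Fr).
  have dw1 : differentiable w1 x.
    by apply: diff_ip => //; exact: smoothC3_diff (frame_e2 Fr) Wx.
  have d1c : differentiable (fun _ : 'rV[R]_2 => 1 : R) x by exact: differentiable_cst.
  have dcc := diffMf dc dc; have dww := diffMf dw1 dw1.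
  have dNc := diffNf dcc; have dQ1 := diffDf d1c dNc.
  have dN : differentiable N x by exact: diffDf.
  have dQ : differentiable Q x by exact: diffMf.
  have dg : differentiable g x by apply: diffMf => //; exact: diffVf (Q0 _ Wx x0).
  split=> // l; rewrite -partialE (partial_frame Fr _ _ Wx).
  have gQ V : vder V g x * Q x + g x * vder V Q x = vder V N x.
    rewrite -(vderM V dg dQ); apply: near_eq_vder.
    apply: filterS (near_ccos_neq0 Wx x0) => y [Wy y0].
    by rewrite /g divfK // Q0.
  have VN V : vder V N x = 2 * w1 x * vder V w1 x.
    by rewrite /N (vderD V d1c dww) vder_cst (vderM V dw1 dw1); ring.
  have VQ V : vder V Q x = 2 * c x * (1 - 2 * c x ^+ 2) * vder V c x.
    rewrite /Q (vderM V dQ1 dcc) (vderD V d1c dNc) vder_cst (vderN V dcc) (vderM V dc dc).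
    by ring.
  have [c1 c2] := vder_ccos Wx; have [dw1_1 dw1_2] := vder_omega1 Wx x0.
  have g1 : vder E1 g x = 0.
    apply: (mulIf (Q0 _ Wx x0)); move: (gQ E1).
    by rewrite VN VQ c1 dw1_1 !mulr0 addr0 mul0r.
  have g2 : vder E2 g x = 0.
    apply: (mulIf (Q0 _ Wx x0)); move: (gQ E2); rewrite VN VQ c2 mul0r.
    move/(canRL (addrK _)) => ->; apply: (mulfI (mulf_neq0 s0 s0)).
    rewrite mulr0 /g /N /Q; move: dw1_2 (csin2 Cf Wx) s0 x0.
    move: (d2 w1 x) (w1 x) (c x) (s x) => z o y t o2 E t0 y0.
    have t2 : 1 + - (y * y) = t * t by rewrite -E; ring.
    rewrite t2; transitivity (2 * o * (t ^+ 2 * z) -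
       (1 + o * o) * 2 * (1 - 2 * y ^+ 2) * o); first by field; rewrite y0 t0.
    have t2' : t ^+ 2 = 1 - y ^+ 2 by rewrite expr2 -t2; ring.
    by rewrite o2 t2'; ring.
  by rewrite g1 g2 !mulr0 addr0.
have ng : \forall x \near w, g x = g w.
  by apply: near_constant; apply: filterS (near_ccos_neq0 Ww c0).
near=> x.
have [Wx x0] : W x /\ c x != 0 by near: x; exact: near_ccos_neq0.
have : g x = g w by near: x.
move/eqP; rewrite /g eqr_div ?Q0 // => /eqP.
by rewrite /N /Q !expr2.
Unshelve. all: by end_near.
Qed.

(** At a critical point the first integral equals [(sin beta * cos beta) ^ -2], and it
    is at least that at other points. Hence [t (1 - t)], where [t = cos^2 beta], has a
    minimum at [w], while [t] has a maximum there and [t (1 - t)] is increasing for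
    [t <= 1 / 2]. *)
Lemma ccos_near_max w : W w -> c w != 0 -> d2 c w = 0 -> 2 * c w ^+ 2 <= 1 ->
  (\forall x \near w, c x ^+ 2 <= c w ^+ 2) ->
  \forall x \near w, c x ^+ 2 = c w ^+ 2.
Proof.
move=> Ww c0 dc0 half cmax.
have o0 : w1 w = 0.
  have [_] := vder_ccos Ww; rewrite dc0 => /esym/eqP.
  by rewrite mulf_eq0 (negPf c0) => /eqP.
near=> x.
have le : c x ^+ 2 <= c w ^+ 2 by near: x.
have : (1 + w1 x ^+ 2) * ((1 - c w ^+ 2) * c w ^+ 2) =
       (1 + w1 w ^+ 2) * ((1 - c x ^+ 2) * c x ^+ 2) by near: x; exact: first_integral.
rewrite o0 expr0n addr0 mul1r; move: le half (contact_lt1 Cf Ww) (sqr_ge0 (c w)) (sqr_ge0 (w1 x)).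
move: (c x ^+ 2) (c w ^+ 2) (w1 x ^+ 2) => t t0 o le half lt1 t00 o00 E.
apply/eqP; rewrite eq_le le /= leNgt; apply/negP => lt.
have : 0 < (t0 - t) * (1 - t0 - t) by rewrite mulr_gt0 ?subr_gt0 //; lra.
have : 0 <= o * ((1 - t0) * t0) by rewrite !mulr_ge0 // subr_ge0 ltW.
by lra.
Unshelve. all: by end_near.
Qed.

End lagrangian.

(** * The Gauss equation *)

Section gauss.
Variables (R : realType) (W : set 'rV[R]_2) (X e1 e2 : 'rV[R]_2 -> 'C3[R]).
Hypothesis Fr : orthonormal_frame W X e1 e2.
Local Notation E1 := (E1 X e1 e2).
Local Notation E2 := (E2 X e1 e2).
Local Notation D1 := (vderC3 E1).
Local Notation D2 := (vderC3 E2).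
Local Notation Xd := (fun i => partialC3 i X).
Local Notation Xdd := (fun i j => partialC3 i (partialC3 j X)).

Let oW : open W. Proof. exact: frame_open Fr. Qed.
Let sX : smoothC3 W X. Proof. exact: frame_X Fr. Qed.

Let g (i j : 'I_2) (w : 'rV[R]_2) : R := ip (partialC3 i X w) (partialC3 j X w).
Let A (i j m : 'I_2) (w : 'rV[R]_2) : R :=
  ip (partialC3 i (partialC3 j X) w) (partialC3 m X w).
Let dg (w : 'rV[R]_2) : R := g 0 0 w * g 1 1 w - g 0 1 w * g 0 1 w.

Let gC i j w : g i j w = g j i w. Proof. exact: ipC. Qed.

Lemma metric_ip w i j : metric X w i j = ip (partialC3 i X w) (partialC3 j X w).
Proof. by rewrite mxE inner_ip !partialC3E. Qed.

Lemma g_theta w i j : W w -> ip (partialC3 i X w) (partialC3 j X w) =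
  theta X e1 i w * theta X e1 j w + theta X e2 i w * theta X e2 j w.
Proof.
move=> Ww; rewrite [partialC3 j X w](partialC3_frame Fr X j Ww).
by have [-> ->] := vder_X Fr Ww; rewrite ipDr !ipZr /theta mulrC [X in _ + X]mulrC.
Qed.

Let dg_area w : W w -> dg w = area X e1 e2 w ^+ 2.
Proof. by move=> Ww; rewrite /dg /g !g_theta // /area; ring. Qed.

Let dg0 w : W w -> dg w != 0.
Proof. by move=> Ww; rewrite dg_area // expf_neq0 //; have [] := frame_dual Fr Ww. Qed.

Lemma I2_cases (l : 'I_2) : l = 0 \/ l = 1.
Proof. by case: l => -[|[|//]] ?; [left|right]; exact/val_inj. Qed.

Lemma det2 (M : 'M[R]_2) : \det M = M 0 0 * M 1 1 - M 0 1 * M 1 0.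
Proof.
rewrite (expand_det_row _ 0) sum2 /cofactor !det_mx11 !mxE /= expr0 expr1.
have -> : lift 0 0 = 1 :> 'I_2 by exact/val_inj.
have -> : lift 1 0 = 0 :> 'I_2 by exact/val_inj.
by ring.
Qed.

Lemma invmx2 (M : 'M[R]_2) (d := M 0 0 * M 1 1 - M 0 1 * M 1 0) : d != 0 ->
  [/\ invmx M 0 0 = M 1 1 / d, invmx M 0 1 = - M 0 1 / d,
      invmx M 1 0 = - M 1 0 / d & invmx M 1 1 = M 0 0 / d].
Proof.
move=> d0; pose B : 'M[R]_2 := \matrix_(i, j)
  (if i == 0 then if j == 0 then M 1 1 / d else - M 0 1 / d
   else if j == 0 then - M 1 0 / d else M 0 0 / d).
have MB : M *m B = 1%:M.
  apply/matrixP => i j; rewrite !mxE sum2 !mxE.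
  by case: (I2_cases i) => ->; case: (I2_cases j) => -> /=; move: d0; rewrite /d => d0; field.
have uM : M \in unitmx by have [] := mulmx1_unit MB.
have -> : invmx M = B by rewrite -[RHS](mulKmx uM) MB mulmx1.
by split; rewrite mxE.
Qed.

(** Solving [sum_l Gamma^l_ij g_lm = <d_i d_j X, d_m X>] for the symbols. *)
Let Gam (l i j : 'I_2) (w : 'rV[R]_2) : R :=
  if l == 0 then (g 1 1 w * A i j 0 w - g 0 1 w * A i j 1 w) / dg w
  else (g 0 0 w * A i j 1 w - g 0 1 w * A i j 0 w) / dg w.

Let g_diff i j w : W w -> differentiable (g i j) w.
Proof. by move=> Ww; apply: diff_ip; exact: partialC3_diff sX Ww. Qed.

Let A_diff i j m w : W w -> differentiable (A i j m) w.
Proof.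
move=> Ww; apply: diff_ip; last exact: partialC3_diff sX Ww.
by apply: partialC3_diff Ww; exact: smoothC3_partial.
Qed.

Let Gam_diff l i j w : W w -> differentiable (Gam l i j) w.
Proof.
move=> Ww; have ddg : differentiable dg w.
  by apply: diffDf; [|apply: diffNf]; apply: diffMf; exact: g_diff.
have dinv := diffVf ddg (dg0 Ww).
rewrite /Gam; case: (l == 0); apply: diffMf => //;
 by apply: diffDf; [|apply: diffNf]; apply: diffMf; (exact: g_diff || exact: A_diff).
Qed.

Let partial_g k i j w : W w -> partial k (g i j) w = A k i j w + A k j i w.
Proof.
move=> Ww; rewrite (pd_ip k (partialC3_diff i sX Ww) (partialC3_diff j sX Ww)).
by rewrite [X in _ + X]ipC.
Qed.

Let A_sym i j m w : W w -> A i j m w = A j i m w.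
Proof. by move=> Ww; rewrite /A (partialC3_comm oW i j sX Ww). Qed.

Let christoffel_Gam l i j w : W w -> christoffel X l i j w = Gam l i j w.
Proof.
move=> Ww; have d0 := dg0 Ww.
have gE m n : (fun w => metric X w m n) = g m n.
  by apply/funext => x; exact: metric_ip.
have S m : pd i (fun w => metric X w j m) w + pd j (fun w => metric X w i m) w -
    pd m (fun w => metric X w i j) w = 2 * A i j m w.
  rewrite !gE -!partialE !partial_g // (A_sym j i m Ww) (A_sym m i j Ww) (A_sym m j i Ww).
  by ring.
have mg m n : metric X w m n = g m n w by exact: metric_ip.
have d0' : metric X w 0 0 * metric X w 1 1 - metric X w 0 1 * metric X w 1 0 != 0.
  by rewrite !mg (gC 1 0).
have [I00 I01 I10 I11] := invmx2 d0'.
rewrite /christoffel sum2 !S /Gam.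
case: (I2_cases l) => -> /=; rewrite ?I00 ?I01 ?I10 ?I11 !mg !(gC 1 0) -/(dg w).
all: move: (g _ _ w) (g _ _ w) (A _ _ _ w) (A _ _ _ w) (dg w) d0 => *; field => //.
Qed.

Let Gam_g i j m w : W w ->
  Gam 0 i j w * g 0 m w + Gam 1 i j w * g 1 m w = A i j m w.
Proof.
move=> Ww; have d0 := dg0 Ww; rewrite /Gam /=; move: d0; rewrite /dg.
case: (I2_cases m) => ->; rewrite ?(gC 1 0).
all: move: (g 0 0 w) (g 0 1 w) (g 1 1 w) (A i j 0 w) (A i j 1 w) => *; field => //.
Qed.

(** The part of the inner product of C^3 orthogonal to the tangent plane. *)
Definition normal_ip w (u v : 'C3[R]) : R :=
  ip u v - ip u (e1 w) * ip v (e1 w) - ip u (e2 w) * ip v (e2 w).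

Let Gam_tangent i j w v : W w ->
  ip (partialC3 i (partialC3 j X) w) v
   - (Gam 0 i j w * ip (partialC3 0 X w) v + Gam 1 i j w * ip (partialC3 1 X w) v) =
  normal_ip w (partialC3 i (partialC3 j X) w) v.
Proof.
move=> Ww; have [A0 X0 X1] := frame_dual Fr Ww.
have h m := Gam_g i j m Ww.
have [T1 T2] :
    Gam 0 i j w * theta X e1 0 w + Gam 1 i j w * theta X e1 1 w =
      ip (partialC3 i (partialC3 j X) w) (e1 w) /\
    Gam 0 i j w * theta X e2 0 w + Gam 1 i j w * theta X e2 1 w =
      ip (partialC3 i (partialC3 j X) w) (e2 w).
  have := (h 0, h 1); rewrite /A /g !g_theta // X0 X1 !ipDr !ipZr; move: A0; rewrite /area.
  move: (theta X e1 0 w) (theta X e2 1 w) (theta X e1 1 w) (theta X e2 0 w) (Gam 0 i j w)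
    (Gam 1 i j w) (ip _ (e1 w)) (ip _ (e2 w)) => t10 t21 t11 t20 g0 g1 p q A0 [H0 H1].
  split; apply: (mulfI A0).
    have : t21 * (g0 * (t10 * t10 + t20 * t20) + g1 * (t11 * t10 + t21 * t20)) -
           t20 * (g0 * (t10 * t11 + t20 * t21) + g1 * (t11 * t11 + t21 * t21)) =
           t21 * (t10 * p + t20 * q) - t20 * (t11 * p + t21 * q) by rewrite H0 H1.
    by lra.
  have : t10 * (g0 * (t10 * t11 + t20 * t21) + g1 * (t11 * t11 + t21 * t21)) -
         t11 * (g0 * (t10 * t10 + t20 * t20) + g1 * (t11 * t10 + t21 * t20)) =
         t10 * (t11 * p + t21 * q) - t11 * (t10 * p + t20 * q) by rewrite H0 H1.
  by lra.
rewrite /normal_ip -T1 -T2 X0 X1 !ipDl !ipZl !(ipC v).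
move: (Gam _ _ _ _) (Gam _ _ _ _) (ip _ v) (ip (e1 w) v) (ip (e2 w) v) => *; ring.
Qed.

(** The derivatives of [Gam_g] express those of the Christoffel symbols; the third
    derivatives of [X] cancel by symmetry. *)
Lemma gauss_raw w : W w ->
  gauss_curvature X w * area X e1 e2 w ^+ 2 =
  normal_ip w (partialC3 1 (partialC3 1 X) w) (partialC3 0 (partialC3 0 X) w)
  - normal_ip w (partialC3 0 (partialC3 1 X) w) (partialC3 0 (partialC3 1 X) w).
Proof.
move=> Ww.
have K i j l : partial i (A j l 0) w =
   partial i (Gam 0 j l) w * g 0 0 w + Gam 0 j l w * (A i 0 0 w + A i 0 0 w) +
   (partial i (Gam 1 j l) w * g 1 0 w + Gam 1 j l w * (A i 1 0 w + A i 0 1 w)).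
  have E : \forall x \near w, A j l 0 x = Gam 0 j l x * g 0 0 x + Gam 1 j l x * g 1 0 x.
    by apply: filterS (near_in oW Ww) => x Wx; rewrite Gam_g.
  rewrite (near_eq_partial i E).
  rewrite (pdD i (diffMf (Gam_diff 0 j l Ww) (g_diff 0 0 Ww))
                 (diffMf (Gam_diff 1 j l Ww) (g_diff 1 0 Ww))).
  rewrite (pdM i (Gam_diff 0 j l Ww) (g_diff 0 0 Ww)).
  by rewrite (pdM i (Gam_diff 1 j l Ww) (g_diff 1 0 Ww)) !partial_g.
have sXi i : smoothC3 W (partialC3 i X) by exact: smoothC3_partial.
have L i j l : partial i (A j l 0) w =
    ip (partialC3 i (partialC3 j (partialC3 l X)) w) (partialC3 0 X w) +
    ip (partialC3 j (partialC3 l X) w) (partialC3 i (partialC3 0 X) w).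
  exact: (pd_ip i (partialC3_diff j (sXi l) Ww) (partialC3_diff 0 sX Ww)).
have third_sym : partialC3 0 (partialC3 1 (partialC3 1 X)) w =
                 partialC3 1 (partialC3 0 (partialC3 1 X)) w.
  exact: (partialC3_comm oW 0 1 (sXi 1) Ww).
have cG l i j k : pd k (christoffel X l i j) w = partial k (Gam l i j) w.
  rewrite -partialE; apply: near_eq_partial; apply: filterS (near_in oW Ww) => x Wx.
  exact: christoffel_Gam.
have mg m n : metric X w m n = g m n w by exact: metric_ip.
have det2 : \det (metric X w) = dg w.
  by rewrite det2 !mg (gC 1 0).
rewrite /gauss_curvature det2 -dg_area // divfK ?dg0 //.
rewrite sum2 /riemann !sum2 !cG !christoffel_Gam // !mg.
rewrite -!Gam_tangent //.
have := K 0 1 1; have := K 1 0 1; rewrite !L third_sym.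
rewrite (partialC3_comm oW 1 0 sX Ww) !(ipC (partialC3 _ X w)).
rewrite -!/(A _ _ _ w) (A_sym 1 0 0 Ww) (A_sym 1 0 1 Ww).
rewrite -(Gam_g 0 0 0 Ww) -(Gam_g 0 1 0 Ww) -(Gam_g 1 1 0 Ww).
have G10 l : Gam l 1 0 w = Gam l 0 1 w by rewrite /Gam !(A_sym 1 0 _ Ww).
rewrite !G10.
move: (partial 1 (Gam 0 0 1) w) (partial 1 (Gam 1 0 1) w) (partial 0 (Gam 0 1 1) w)
 (partial 0 (Gam 1 1 1) w) => q1 q2 q3 q4.
move: (g 0 0 w) (g 1 0 w) (A 0 0 1 w) (A 0 1 1 w) => y1 y2 y3 y4.
move: (Gam 0 0 0 w) (Gam 1 0 0 w) (Gam 0 0 1 w) (Gam 1 0 1 w) (Gam 0 1 1 w) (Gam 1 1 1 w).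
move: (ip _ _) (ip _ _) (ip _ _) => x1 x2 x3 g1 g2 g3 g4 g5 g6 H1 H2.
by lra.
Qed.

Lemma normal_ipC w u v : normal_ip w u v = normal_ip w v u.
Proof. by rewrite /normal_ip (ipC u v) (mulrC (ip u (e1 w))) (mulrC (ip u (e2 w))). Qed.

Lemma normal_ipDl w u u' v : normal_ip w (u + u') v = normal_ip w u v + normal_ip w u' v.
Proof. by rewrite /normal_ip !ipDl; move: (ip _ _) (ip _ _) (ip _ _) => *; ring. Qed.

Lemma normal_ipZl w r u v : normal_ip w (sc r u) v = r * normal_ip w u v.
Proof. by rewrite /normal_ip !ipZl; move: (ip _ _) (ip _ _) (ip _ _) => *; ring. Qed.

Lemma normal_ip_tangent w v : W w -> normal_ip w (e1 w) v = 0 /\ normal_ip w (e2 w) v = 0.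
Proof.
move=> Ww; rewrite /normal_ip (frame_11 Fr Ww) (frame_22 Fr Ww) (ipC (e2 w) (e1 w)).
by rewrite (frame_12 Fr Ww) !(ipC v); split; ring.
Qed.

Lemma normal_ip_second i j w v : W w ->
  normal_ip w (partialC3 i (partialC3 j X) w) v =
    theta X e1 i w * theta X e1 j w * normal_ip w (D1 e1 w) v +
    (theta X e2 i w * theta X e1 j w + theta X e1 i w * theta X e2 j w) *
      normal_ip w (D2 e1 w) v +
    theta X e2 i w * theta X e2 j w * normal_ip w (D2 e2 w) v.
Proof.
move=> Ww.
have de1 := smoothC3_diff (frame_e1 Fr) Ww; have de2 := smoothC3_diff (frame_e2 Fr) Ww.
have [N1 N2] := normal_ip_tangent v Ww.
have T12 : normal_ip w (D1 e2 w) v = normal_ip w (D2 e1 w) v.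
  have [T _] := torsion_free Fr Ww; move/(canRL (subrK _)): T => ->.
  by rewrite opprD -!scN !normal_ipDl !normal_ipZl N1 N2 !mulr0 !add0r.
have dt1 := theta_diff Fr j Ww de1; have dt2 := theta_diff Fr j Ww de2.
have E : \forall x \near w, partialC3 j X x =
    sc (theta X e1 j x) (e1 x) + sc (theta X e2 j x) (e2 x).
  apply: filterS (near_in oW Ww) => x Wx; rewrite (partialC3_frame Fr X j Wx).
  by have [-> ->] := vder_X Fr Wx.
rewrite (near_eq_pdC3 i E) (pdC3D i (diffC3Z dt1 de1) (diffC3Z dt2 de2)).
rewrite (pdC3Z i dt1 de1) (pdC3Z i dt2 de2).
rewrite (partialC3_frame Fr e1 i Ww) (partialC3_frame Fr e2 i Ww).
rewrite !(normal_ipDl, normal_ipZl) T12 N1 N2.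
move: (normal_ip _ _ _) (normal_ip _ _ _) (normal_ip _ _ _) => x y z.
by move: (theta X e1 i w) (theta X e1 j w) (theta X e2 i w) (theta X e2 j w) => *; ring.
Qed.

Lemma gauss_equation w : W w ->
  gauss_curvature X w = normal_ip w (D1 e1 w) (D2 e2 w) - normal_ip w (D2 e1 w) (D2 e1 w).
Proof.
move=> Ww; have [A0 _ _] := frame_dual Fr Ww; have N i j v := normal_ip_second i j v Ww.
have := gauss_raw Ww; rewrite !N ![normal_ip w _ (partialC3 _ _ _)]normal_ipC !N.
rewrite [normal_ip w (D2 e1 w) (D1 e1 w)]normal_ipC [normal_ip w (D2 e2 w) (D1 e1 w)]normal_ipC
  [normal_ip w (D2 e2 w) (D2 e1 w)]normal_ipC.
move: A0; rewrite /area => A0 H; apply: (mulIf (expf_neq0 2 A0)); rewrite H.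
move: (normal_ip _ _ _) (normal_ip _ _ _) (normal_ip _ _ _) (normal_ip _ _ _) (normal_ip _ _ _)
  (normal_ip _ _ _) => *.
by move: (theta X e1 0 w) (theta X e1 1 w) (theta X e2 0 w) (theta X e2 1 w) => *; ring.
Qed.

(** The mean curvature vector is half the trace of the second fundamental form in
    any orthonormal frame. *)
Lemma minimal_trace w m : W w -> mean_curvature X w = 0 ->
  ip (X w) m = 0 -> ip (e1 w) m = 0 -> ip (e2 w) m = 0 ->
  ip (D1 e1 w + D2 e2 w) m = 0.
Proof.
move=> Ww H0 Xm m1 m2; have [A0 _ _] := frame_dual Fr Ww.
have Nm v : normal_ip w v m = ip v m.
  by rewrite /normal_ip !(ipC m) m1 m2 !mulr0 !subr0.
have Xdm l : ip (partialC3 l X w) m = 0.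
  rewrite (partialC3_frame Fr X l Ww); have [-> ->] := vder_X Fr Ww.
  by rewrite ipDl !ipZl m1 m2 !mulr0 addr0.
have II i j : ip (second_form X i j w) m = normal_ip w (partialC3 i (partialC3 j X) w) m.
  rewrite Nm /second_form /normal_part /covD -!partialC3E !scale_sc.
  rewrite ipDl ipNl ipDl ipNl ipZl Xm mulr0 subr0.
  rewrite ip_suml big1 ?subr0 // => i' _.
  rewrite ip_suml big1 // => j' _.
  by rewrite scale_sc ipZl -!partialC3E Xdm mulr0.
have : \sum_i \sum_j invmx (metric X w) i j *
    normal_ip w (partialC3 i (partialC3 j X) w) m = 0.
  have := congr1 (fun v => ip v m) H0; rewrite /mean_curvature scale_sc ipZl ip0l ip_suml.
  move/eqP; rewrite mulf_eq0 invr_eq0 pnatr_eq0 /= => /eqP H; apply: etrans H.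
  apply: eq_bigr => i _.
  by rewrite ip_suml; apply: eq_bigr => j _; rewrite scale_sc ipZl II.
rewrite sum2 (sum2 (fun j => _ 0 j * _)) (sum2 (fun j => _ 1 j * _)).
rewrite !(normal_ip_second _ _ _ Ww) !Nm ipDl.
have mg i j : metric X w i j = g i j w by exact: metric_ip.
have d0 := dg0 Ww.
have d0' : metric X w 0 0 * metric X w 1 1 - metric X w 0 1 * metric X w 1 0 != 0.
  by rewrite !mg (gC 1 0).
have [-> -> -> ->] := invmx2 d0'; rewrite !mg (gC 1 0).
move: d0; rewrite (dg_area Ww) /dg /g !g_theta //; move: A0; rewrite /area.
move: (theta X e1 0 w) (theta X e1 1 w) (theta X e2 0 w) (theta X e2 1 w) => a b c d A0 d0.
move: (ip _ m) (ip _ m) (ip _ m) => x y z.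
have -> : (a * a + c * c) * (b * b + d * d) - (a * b + c * d) * (a * b + c * d) =
          (a * d - b * c) ^+ 2 by ring.
by move=> <-; field.
Qed.

End gauss.

(** * Curvature at a critical point of the contact angle *)

Section gauss_lagrangian.
Variables (R : realType) (X e1 e2 : 'rV[R]_2 -> 'C3[R]) (k sg a : R) (W : set 'rV[R]_2).
Hypothesis Cf : contact_frame X e1 e2 k sg W a.
Local Notation E1 := (E1 X e1 e2).
Local Notation E2 := (E2 X e1 e2).
Local Notation D1 := (vderC3 E1).
Local Notation D2 := (vderC3 E2).
Local Notation c := (ccos X e2).
Local Notation s := (csin X e2).
Local Notation n := (third X e1 e2 k sg).

(** The connection form vanishes at [w], so that [e1] and [e2] are principal, with
    opposite second fundamental forms, multiples of [i n] of length [|cot beta|]. *)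
Lemma gauss_at_critical w : k = 0 -> a = 0 -> W w -> c w != 0 -> vder E2 c w = 0 ->
  gauss_curvature X w = 1 - c w ^+ 2 / s w ^+ 2.
Proof.
move=> k0 a0 Ww c0 dc0; have Fr := contact_orthonormal Cf.
have s0 := csin_neq0 Cf Ww.
have [d1c d2c] := vder_ccos Cf k0 a0 Ww.
have o1 : omega1 X e1 e2 w = 0.
  by apply: (mulfI c0); rewrite -d2c dc0 mulr0.
have o2 : omega2 X e1 e2 w = 0.
  by apply: (mulfI c0); rewrite (ccos_omega2 Cf k0 a0 Ww) mulr0.
have [[_ _ Q1 Q2] [[m1 m2 P1 P2] _]] := first_order Cf Ww.
rewrite /tauIm /mu /tauRe in Q1 Q2 m1 m2 P1 P2.
have kx x : k * x = 0 by rewrite k0 mul0r.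
have z : [/\ ip (D1 e1 w) (mI (e1 w)) = 0, ip (D1 e1 w) (n w) = 0,
   ip (D2 e1 w) (mI (e1 w)) = 0, ip (D2 e1 w) (n w) = 0 & ip (D2 e1 w) (mI (n w)) = 0].
  by rewrite m1 m2 P1 P2 Q2 o1 o2 a0 !kx !mul0r subrr !mulr0 subr0 addr0 oppr0.
case: z => z1 z2 z3 z4 z5.
have G := gram Cf Ww; have G2 := gram_e2 Cf Ww; have DD := ip_D Cf Ww.
have D2e2X : ip (D2 e2 w) (X w) = -1.
  rewrite (vder_cst_ip Fr E2 Ww (smoothC3_diff (frame_e2 Fr) Ww)
             (smoothC3_diff (frame_X Fr) Ww) (r := 0)).
    by have [_ ->] := vder_X Fr Ww; rewrite (frame_22 Fr Ww).
  by move=> x Wx; rewrite (gram_e2 Cf Wx).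
have D2e2in : ip (D2 e2 w) (mI (n w)) = sg * c w / s w.
  have := @contact_minimal _ _ _ _ _ _ _ _ Cf w (mI (n w)) Ww.
  rewrite !G !G2 ipDl Q1 => /(_ erefl erefl erefl).
  by move/eqP; rewrite addrC subr_eq0 => /eqP.
have Pa z v := parseval z v (unitary Cf Ww).
rewrite (gauss_equation Fr Ww) /normal_ip.
have -> : ip (D1 e1 w) (e2 w) = 0 by exact: o1.
have -> : ip (D2 e1 w) (e2 w) = 0 by exact: o2.
rewrite (Pa (D1 e1 w) (D2 e2 w)) (Pa (D2 e1 w) (D2 e1 w)) !DD z1 z2 z3 z4 z5 Q1 D2e2X D2e2in.
have sg1 : sg * sg = 1 by have := contact_ksg Cf; rewrite k0 expr0n add0r expr2.
rewrite (mulrC (s w) k) kx !(mul0r, mulr0, addr0, add0r, subr0).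
transitivity (1 - sg * sg * c w ^+ 2 / s w ^+ 2); last by rewrite sg1 mul1r.
by move: (c w) (s w) s0 => x y y0; field.
Qed.

Lemma half_of_gauss_ge0 w : k = 0 -> a = 0 -> W w -> c w != 0 -> vder E2 c w = 0 ->
  0 <= gauss_curvature X w -> 2 * c w ^+ 2 <= 1.
Proof.
move=> k0 a0 Ww c0 dc0; rewrite gauss_at_critical // subr_ge0.
have s2 : 0 < s w ^+ 2 by rewrite exprn_gt0 // (csin_gt0 Cf).
rewrite ler_pdivrMr // mul1r; have := csin2 Cf Ww.
by move: (c w ^+ 2) (s w ^+ 2) => x y; lra.
Qed.

End gauss_lagrangian.

(** * From the data of the theorem to a contact frame *)

Section local_extremum.
Variable R : realType.

Lemma pd_max (f : 'rV[R]_2 -> R) (k : 'I_2) u :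
  (\forall w \near u, differentiable f w /\ f w <= f u) -> pd k f u = 0.
Proof.
move=> /nbhs_ballP[e /= e0 He].
have He' t : t \in `](- e), e[%R ->
    differentiable f (u + t *: 'e_k) /\ f (u + t *: 'e_k) <= f u.
  rewrite in_itv /= => /andP[t1 t2]; apply: He.
  rewrite -ball_normE /= opprD addNKr normrN normrZ.
  apply: le_lt_trans (_ : `|t| < e); last by rewrite ltr_norml t1.
  by rewrite ler_piMr // norm_basis_le1.
have d t : t \in `](- e), e[%R ->
    is_derive t 1 (fun r : R => f (u + r *: 'e_k)) (pd k f (u + t *: 'e_k)).
  by move=> /He'[/is_derive_line].
have i0 : 0 \in `](- e), e[%R by rewrite in_itv /= oppr_lt0 e0.
have := @derive1_at_max R (fun r => f (u + r *: 'e_k)) (- e) e 0.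
case.
- by rewrite ge0_cp ?ltW.
- by move=> t /d dt; exact: ex_derive.
- exact: i0.
- by move=> t /He'[_]; rewrite scale0r addr0.
move=> _; have := d 0 i0; rewrite scale0r addr0 => dd.
by rewrite derive_val => <-.
Qed.

End local_extremum.

Section bridge.
Variables (R : realType) (X e1 e2 : 'rV[R]_2 -> 'C3[R]) (alpha a : R) (W : set 'rV[R]_2).
Hypotheses (oW : open W) (sX : smoothC3 W X) (ad : adapted_frame X W e1 e2)
  (X5 : forall w, W w -> S5 (X w))
  (minX : forall w, W w -> mean_curvature X w = 0)
  (alpha0 : alpha <> 0 /\ alpha <> pi)
  (alphaE : forall w, W w -> alpha = holomorphic_angle (X w) (e1 w) (e2 w))
  (betaP : forall w, W w ->
     contact_angle (X w) (e2 w) <> 0 /\ contact_angle (X w) (e2 w) <> pi)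
  (thetaE : forall w k, W w -> theta13 X e1 e2 k w = a * coframe X e1 k w).
Local Notation c := (ccos X e2).
Local Notation s := (csin X e2).
Local Notation v w := (vvec (X w) (e2 w)).

Lemma adapted_orthonormal : orthonormal_frame W X e1 e2.
Proof.
have [s1 s2 H] := ad.
by split=> // w Ww; have [[t1 t2 _] [n1 n2 n12]] := H w Ww; rewrite -?inner_ip.
Qed.

Let Fr := adapted_orthonormal.

Let XX w : W w -> ip (X w) (X w) = 1.
Proof. by move=> Ww; rewrite -inner_ip /inner (X5 Ww). Qed.

Let Xi1 w : W w -> ip (mI (X w)) (e1 w) = 0.
Proof.
have [s1 s2 H] := ad; move=> Ww; have [[_ _ ce] _] := H w Ww; case: ce => _ ce.
by rewrite -ce inner_ip /reeb mulI_mI.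
Qed.

Let ccosE w : inner (reeb (X w)) (e2 w) = c w.
Proof. by rewrite inner_ip /reeb mulI_mI. Qed.

Let c_bound w : W w -> -1 <= c w <= 1.
Proof.
by move=> Ww; apply: cauchy_schwarz; rewrite ?ip_mI2 ?XX // (frame_22 Fr Ww).
Qed.

Let c_lt1 w : W w -> c w ^+ 2 < 1.
Proof.
move=> Ww; have [b0 bpi] := betaP Ww; have /andP[c1 c2] := c_bound Ww.
rewrite /contact_angle ccosE in b0 bpi.
have cn1 : c w != 1 by apply/eqP => E; apply: b0; rewrite E acos1.
have cnN1 : c w != -1 by apply/eqP => E; apply: bpi; rewrite E acosN1.
have c3 : -1 < c w by rewrite lt_neqAle eq_sym cnN1.
have c4 : c w < 1 by rewrite lt_neqAle cn1.
have : 0 < (1 - c w) * (1 + c w) by apply: mulr_gt0; move: c3 c4; lra.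
by move: (c w) => x; lra.
Qed.

Let s_gt0 w : W w -> 0 < s w.
Proof. by move=> Ww; rewrite sqrtr_gt0 subr_gt0 c_lt1. Qed.

Let vE w : W w -> v w = sc (s w)^-1 (e2 w + sc (- c w) (mI (X w))).
Proof.
move=> Ww; have E : projD (X w) (e2 w) = e2 w + sc (- c w) (mI (X w)).
  by rewrite /projD ccosE scale_sc /reeb mulI_mI scN.
rewrite /vvec E /unit_dir scale_sc inner_ip; congr (sc (Num.sqrt _)^-1 _).
rewrite !(ipDl, ipDr) !(ipZl, ipZr) (frame_22 Fr Ww) ip_mI2 XX // (ipC (e2 w)) -/(c w).
by move: (c w) => x; ring.
Qed.

Let Xtan w : W w -> ip (X w) (e1 w) = 0 /\ ip (X w) (e2 w) = 0.
Proof.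
move=> Ww; have [V1 V2] := vder_X Fr Ww.
have dX := smoothC3_diff sX Ww.
rewrite -V1 -V2 !(ipC (X w)).
by split; exact: (vder_ip_unit Fr _ Ww dX XX).
Qed.

Let i1X w : W w -> ip (mI (e1 w)) (mI (X w)) = 0.
Proof. by move=> Ww; rewrite ip_mI2 ipC; have [] := Xtan Ww. Qed.

Let v_unit w : W w -> ip (v w) (v w) = 1.
Proof.
move=> Ww; rewrite vE // !(ipZl, ipZr, ipDl, ipDr) (frame_22 Fr Ww) ip_mI2 XX //.
rewrite (ipC (e2 w)) -/(c w); have s0 := lt0r_neq0 (s_gt0 Ww).
have : s w ^+ 2 = 1 - c w ^+ 2 by rewrite sqr_sqrtr // subr_ge0 ltW // c_lt1.
move: (c w) (s w) s0 => x y y0 E; apply: (mulfI (expf_neq0 2 y0)).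
by rewrite mulr1 {2}E; field.
Qed.

Let holo_bound w : W w -> -1 <= ip (mI (e1 w)) (v w) <= 1.
Proof.
by move=> Ww; apply: cauchy_schwarz; rewrite ?ip_mI2 ?(frame_11 Fr Ww) ?v_unit.
Qed.

Let cos_alpha w : W w -> cos alpha = ip (mI (e1 w)) (v w).
Proof.
move=> Ww; rewrite (alphaE Ww) /holomorphic_angle inner_ip mulI_mI acosK //.
by rewrite in_itv /= holo_bound.
Qed.

Let ie1e2 w : W w -> ip (mI (e1 w)) (e2 w) = s w * cos alpha.
Proof.
move=> Ww; rewrite (cos_alpha Ww) vE // ipZr ipDr ipZr i1X // mulr0 addr0.
by rewrite mulVKf // lt0r_neq0 // s_gt0.
Qed.

(** The angle [alpha] being constant, the definition of [e3] in terms of [alpha] and the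
    unit vector along the projection of [e2] reduces to [sg (i e1) - k (third)]. *)
Lemma bridge_contact_frame w0 : W w0 -> contact_frame X e1 e2 (cos alpha) (sin alpha) W a.
Proof.
move=> Ww0; have [a0 api] := alpha0.
have ab : 0 <= alpha <= pi.
  by rewrite (alphaE Ww0) /holomorphic_angle inner_ip mulI_mI acos_ge0 ?acos_lepi // holo_bound.
have sg0 : 0 < sin alpha.
  apply: sin_gt0_pi; case/andP: ab => l1 l2; rewrite !lt_neqAle l1 l2 !andbT.
  by apply/andP; split; [rewrite eq_sym|]; exact/eqP.
have ksg : cos alpha ^+ 2 + sin alpha ^+ 2 = 1 by exact: cos2Dsin2.
have e3E w : W w -> e3vec (X w) (e1 w) (e2 w) =
    sc (sin alpha) (mI (e1 w)) + sc (- cos alpha) (third X e1 e2 (cos alpha) (sin alpha) w).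
  move=> Ww; rewrite /e3vec -(alphaE Ww) /csc /cot !scale_sc mulI_mI vE //.
  rewrite third.unlock (addrA (e2 w)); move: (e2 w + _) (mI (e1 w)) => u v.
  rewrite scDr scDr !scA -scN [sc _ u + _]addrC addrA -scDl.
  have s0 := lt0r_neq0 (s_gt0 Ww); have sa0 := lt0r_neq0 sg0.
  congr (sc _ v + sc _ u); last by field; rewrite s0 sa0.
  transitivity ((cos alpha ^+ 2 + sin alpha ^+ 2) / sin alpha); first by rewrite ksg mul1r.
  by field; rewrite s0 sa0.
have e3X w : W w -> ip (X w) (e3vec (X w) (e1 w) (e2 w)) = 0.
  move=> Ww; have [X1 X2] := Xtan Ww.
  rewrite /e3vec !scale_sc mulI_mI vE // ipDr ipNr !ipZr ipDr ipZr X2 ip_mI.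
  have -> : ip (X w) (mI (e1 w)) = 0 by apply/eqP; rewrite -oppr_eq0 -ip_mIl Xi1.
  by rewrite !mulr0 addr0 !mulr0 subr0.
have T w : W w ->
  ip (vderC3 (E1 X e1 e2) e1 w) (e3vec (X w) (e1 w) (e2 w)) = a /\
  ip (vderC3 (E2 X e1 e2) e1 w) (e3vec (X w) (e1 w) (e2 w)) = 0.
  move=> Ww; have [A0 _ _] := frame_dual Fr Ww.
  have H k : theta X e1 k w * ip (vderC3 (E1 X e1 e2) e1 w) (e3vec (X w) (e1 w) (e2 w)) +
     theta X e2 k w * ip (vderC3 (E2 X e1 e2) e1 w) (e3vec (X w) (e1 w) (e2 w)) =
     a * theta X e1 k w.
    have := thetaE k Ww; rewrite /theta13 /coframe /covD !inner_ip scale_sc.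
    rewrite ipDl ipNl ipZl e3X // mulr0 subr0 -!partialC3E.
    by rewrite (partialC3_frame Fr e1 k Ww) ipDl !ipZl.
  have := (H 0, H 1); move: A0; rewrite /area.
  move: (theta X e1 0 w) (theta X e1 1 w) (theta X e2 0 w) (theta X e2 1 w) (ip _ _) (ip _ _).
  move=> t10 t11 t20 t21 q p A0 [H0 H1]; split; apply: (mulfI A0).
    have : t21 * (t10 * p + t20 * q) - t20 * (t11 * p + t21 * q) =
           t21 * (a * t10) - t20 * (a * t11) by rewrite H0 H1.
    by lra.
  have : t10 * (t11 * p + t21 * q) - t11 * (t10 * p + t20 * q) =
         t10 * (a * t11) - t11 * (a * t10) by rewrite H0 H1.
  by lra.
split=> //.
- exact: lt0r_neq0.
- by move=> w m Ww; apply: (minimal_trace Fr Ww); exact: minX.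
- by move=> w Ww; rewrite -e3E //; have [] := T w Ww.
- by move=> w Ww; rewrite -e3E //; have [] := T w Ww.
Qed.

End bridge.

(** * Global argument *)

Section topology.
Variables (R : realType) (M : topologicalType).

Lemma near_chart (phi : param R M) u (P : M -> Prop) : is_param phi -> dom phi u ->
  (\forall w \near u, P (phi w)) -> \forall q \near phi u, P q.
Proof.
move=> [odom _ _ ophi] du Pw.
have : nbhs u ([set w | P (phi w)] `&` dom phi) by apply: filterI => //; exact: open_nbhs_nbhs.
rewrite nbhsE => -[V [oV Vu] VP].
have : open_nbhs (phi u) (phi @` V) by split; [apply: ophi => // w /VP[] | exists u].
by move/open_nbhs_nbhs; apply: filterS => _ [w /VP[Pphi _] <-].
Qed.

Lemma locally_constant (f : M -> R) : connected [set: M] ->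
  (forall p, \forall q \near p, f q = f p) -> forall p q, f p = f q.
Proof.
move=> cM lc p q.
have open_lvl (P : R -> Prop) : open [set x | P (f x)].
  rewrite openE => x Px; rewrite /interior /=.
  by apply: filterS (lc x) => y /= ->.
have E : [set x | f x = f q] = [set: M].
  apply: cM; first by exists q.
    by exists [set x | f x = f q]; [exact: (open_lvl (fun r => r = f q)) | rewrite setTI].
  exists [set x | f x = f q]; last by rewrite setTI.
  by rewrite -openC; exact: (open_lvl (fun r => r <> f q)).
by have : [set x | f x = f q] p by rewrite E.
Qed.

(** A continuous function with constant square cannot change sign. *)
Lemma sqr_constant (f : M -> R) (m : R) : connected [set: M] -> continuous f ->
  (forall p, f p ^+ 2 = m) -> forall p q, f p = f q.
Proof.
move=> cM cf fm; apply: locally_constant => // p.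
have [p0|p0] := eqVneq (f p) 0.
  by apply: nearW => q; apply/eqP; rewrite p0 -sqrf_eq0 fm -(fm p) p0 expr0n.
have : \forall q \near p, 0 < f q * f p.
  have pp : 0 < f p * f p by rewrite -expr2 exprn_even_gt0.
  have cp : {for p, continuous (fun q => f q * f p)}.
    by apply: cvgM; [exact: cf|exact: cvg_cst].
  exact: cvgr_gt cp _ pp.
apply: filterS => q qp.
have /eqP : f q ^+ 2 = f p ^+ 2 by rewrite !fm.
rewrite eqf_sqr => /orP[/eqP//|/eqP E].
by move: qp; rewrite E mulNr oppr_gt0 -expr2 ltNge sqr_ge0.
Qed.

End topology.

Section global.
Variables (R : realType) (M : topologicalType) (A : set (param R M)) (F : M -> 'C3[R])
  (g : M -> R) (k sg a : R).
Hypothesis surfM : compact_surface A.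
Hypothesis K_ge0 : forall phi u, A phi -> dom phi u -> 0 <= gauss_curvature (F \o phi) u.
Hypothesis local : forall p, exists (phi : param R M) (u : 'rV[R]_2) (W : set 'rV[R]_2)
    (e1 e2 : 'rV[R]_2 -> 'C3[R]),
  [/\ A phi, W u, W `<=` dom phi & phi u = p] /\
  contact_frame (F \o phi) e1 e2 k sg W a /\
  forall w, W w -> g (phi w) = ccos (F \o phi) e2 w.

Let cM : connected [set: M]. Proof. by case: surfM. Qed.
Let Mc : compact [set: M]. Proof. by case: surfM. Qed.
Let chartP phi : A phi -> is_param phi.
Proof. by case: surfM => _ _ _ [H _ _]; exact: H. Qed.

Lemma g_continuous : continuous g.
Proof.
move=> p; have [phi [u [W [e1 [e2 [[Aphi Wu Wd <-] [Cf gE]]]]]]] := local p.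
have Fr := contact_orthonormal Cf.
move=> B; rewrite (gE u Wu) => nB.
apply: (near_chart (chartP Aphi) (Wd _ Wu)).
have cc : {for u, continuous (ccos (F \o phi) e2)}.
  by have d := ccos_diff Cf Wu; exact: differentiable_continuous.
have nB' : \forall w \near u, B (ccos (F \o phi) e2 w) by exact: cc.
have nW := near_in (frame_open Fr) Wu.
near=> w; suff : B (g (phi w)) by [].
by rewrite gE; near: w.
Unshelve. all: by end_near.
Qed.

Lemma critical (eps : R) phi u W e1 e2 : eps != 0 -> A phi -> W u -> W `<=` dom phi ->
  contact_frame (F \o phi) e1 e2 k sg W a ->
  (forall w, W w -> g (phi w) = ccos (F \o phi) e2 w) ->
  (forall q, eps * g q ^+ 2 <= eps * g (phi u) ^+ 2) ->
  ccos (F \o phi) e2 u != 0 ->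
  vder (E1 (F \o phi) e1 e2) (ccos (F \o phi) e2) u = 0 /\
  vder (E2 (F \o phi) e1 e2) (ccos (F \o phi) e2) u = 0.
Proof.
move=> eps0 Aphi Wu Wd Cf gE gmax c0; have Fr := contact_orthonormal Cf.
set c := ccos _ _ in c0 gE *.
have dc w : W w -> differentiable c w by exact: ccos_diff Cf w.
have dcc w : W w -> differentiable (fun x => eps * (c x * c x)) w.
  by move=> Ww; apply: diffMf; [exact: differentiable_cst|apply: diffMf; exact: dc].
have pc j : partial j c u = 0.
  have : pd j (fun x => eps * (c x * c x)) u = 0.
    apply: pd_max; apply: filterS (near_in (frame_open Fr) Wu) => w Ww.
    by split; [exact: dcc|rewrite -!expr2 -!gE].
  rewrite -partialE (pdM j (differentiable_cst eps u) (diffMf (dc _ Wu) (dc _ Wu))).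
  rewrite pd_cst mul0r add0r (pdM j (dc _ Wu) (dc _ Wu)).
  move/eqP; rewrite mulf_eq0 (negPf eps0) /= [c u * _]mulrC -mulrDr mulf_eq0.
  case/orP => /eqP //; move: c0; move: (c u) => x x0 H.
  by case/eqP: x0; move: H; lra.
by rewrite !vderE !pc !mulr0 addr0.
Qed.

Let gmax : M -> exists p, forall q, g q ^+ 2 <= g p ^+ 2.
Proof.
move=> p0; have [||p _ H] := @compact_EVT_max M R (fun p => g p ^+ 2) setT _ Mc.
- by exists p0.
- apply: continuous_subspaceT => x.
  have -> : (fun p => g p ^+ 2) = (fun p => g p * g p) by apply/funext => p; rewrite expr2.
  by apply: cvgM; exact: g_continuous.
by exists p => q; apply: H; rewrite inE.
Qed.

Let gmin : M -> exists p, forall q, g p ^+ 2 <= g q ^+ 2.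
Proof.
move=> p0; have [||p _ H] := @compact_EVT_min M R (fun p => g p ^+ 2) setT _ Mc.
- by exists p0.
- apply: continuous_subspaceT => x.
  have -> : (fun p => g p ^+ 2) = (fun p => g p * g p) by apply/funext => p; rewrite expr2.
  by apply: cvgM; exact: g_continuous.
by exists p => q; apply: H; rewrite inE.
Qed.

(** As [a] is not [0], [omega2] vanishes, so [d g (E1) = 2 k sin beta]; this is [0] at a
    maximum of [g ^ 2], whence [k = 0] and then [omega1 = 0] everywhere. *)
Lemma g_constant_a_neq0 : a != 0 -> forall p q, g p = g q.
Proof.
move=> a0 p0 q0; have [p pmax] := gmax p0.
have k0 : k = 0.
  have [phi [u [W [e1 [e2 [[Aphi Wu Wd phiu] [Cf gE]]]]]]] := local p.
  have w20 : omega2 (F \o phi) e1 e2 u = 0.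
    by apply: (mulfI a0); rewrite mulr0 (codazzi_in Cf Wu).
  have d1c : vder (E1 (F \o phi) e1 e2) (ccos (F \o phi) e2) u = 0.
    have [c0|c0] := eqVneq (ccos (F \o phi) e2 u) 0.
      have Fr := contact_orthonormal Cf.
      rewrite (@near_eq_vder _ _ _ (fun=> 0)) ?vder_cst //.
      apply: filterS (near_in (frame_open Fr) Wu) => w Ww; rewrite -gE //.
      apply/eqP; rewrite -sqrf_eq0 eq_le sqr_ge0 andbT.
      by apply: le_trans (pmax _) _; rewrite -phiu gE // c0 expr0n.
    have [] // := @critical 1 phi u W e1 e2 (oner_neq0 _) Aphi Wu Wd Cf gE _ c0.
    by move=> q; rewrite !mul1r phiu.
  have [[+ _ _ _] _] := first_order Cf Wu; rewrite d1c w20 mulr0 subr0 => /esym/eqP.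
  by rewrite !mulf_eq0 pnatr_eq0 (negPf (csin_neq0 Cf Wu)) => /eqP.
clear p pmax; apply: (locally_constant cM) => p.
have [phi [u [W [e1 [e2 [[Aphi Wu Wd phiu] [Cf gE]]]]]]] := local p.
have Fr := contact_orthonormal Cf; rewrite -phiu.
apply: (near_chart (chartP Aphi) (Wd _ Wu)); rewrite gE //.
have flat w : W w -> differentiable (ccos (F \o phi) e2) w /\
    forall j, pd j (ccos (F \o phi) e2) w = 0.
  move=> Ww; split=> [|j]; first exact: ccos_diff Cf w Ww.
  have w20 : omega2 (F \o phi) e1 e2 w = 0.
    by apply: (mulfI a0); rewrite mulr0 (codazzi_in Cf Ww).
  have s0 := csin_neq0 Cf Ww.
  have w10 : omega1 (F \o phi) e1 e2 w = 0.
    have := codazzi_e3 Cf Ww; rewrite w20 k0.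
    have y2 : 2 + csin (F \o phi) e2 w ^+ 2 != 0.
      by apply: lt0r_neq0; rewrite ltr_wpDr ?sqr_ge0.
    move: s0 y2; move: (omega1 _ _ _ w) (csin _ _ w) (ccos _ _ w) => o y x s0 y2 H.
    have z : a * (2 + y ^+ 2) / y != 0 by rewrite !mulf_neq0 ?invr_eq0.
    apply: (mulfI z); rewrite mulr0 -[RHS]oppr0 -[in RHS]H.
    by field; rewrite s0 (contact_sg Cf).
  have [[c1 c2 _ _] _] := first_order Cf Ww.
  rewrite -partialE (partial_frame Fr _ _ Ww) c1 c2 w10 w20 k0.
  by rewrite !mulr0 subrr !mulr0 addr0.
have nc : \forall w \near u, ccos (F \o phi) e2 w = ccos (F \o phi) e2 u.
  by apply: near_constant; apply: filterS (near_in (frame_open Fr) Wu) => w; exact: flat.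
have nW := near_in (frame_open Fr) Wu.
by near=> w; rewrite gE; near: w.
Unshelve. all: by end_near.
Qed.

(** The sign of [eps] allows for maxima as well as minima. Here the Codazzi equation
    forces [d g (E1) = k (4 sin^2 beta - 1) / (2 sin beta)]. *)
Lemma extremal_value (eps : R) p : a = 0 -> k != 0 -> eps != 0 ->
  (forall q, eps * g q ^+ 2 <= eps * g p ^+ 2) -> 4 * g p ^+ 2 = 3.
Proof.
move=> a0 k0 eps0 pmax; have [phi [u [W [e1 [e2 [[Aphi Wu Wd phiu] [Cf gE]]]]]]] := local p.
rewrite -phiu in pmax *; have s0 := csin_neq0 Cf Wu; have sg0 := contact_sg Cf.
have ke : 2 * omega2 (F \o phi) e1 e2 u * ccos (F \o phi) e2 u * csin (F \o phi) e2 u = k.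
  have := codazzi_e3 Cf Wu; rewrite a0; move: s0.
  move: (omega1 _ _ _ u) (omega2 _ _ _ u) (ccos _ _ u) (csin _ _ u) => o1 o2 x y y0 H.
  have z : sg / y ^+ 2 != 0 by rewrite mulf_neq0 ?invr_eq0 ?expf_neq0.
  apply: (mulfI z); apply/eqP; rewrite -subr_eq0; apply/eqP; rewrite -[RHS]H.
  by field; rewrite y0 sg0.
have c0 : ccos (F \o phi) e2 u != 0.
  by apply/eqP => E; move/eqP: k0; apply; rewrite -ke E mulr0 mul0r.
have [d1c _] := critical eps0 Aphi Wu Wd Cf gE pmax c0.
have [[+ _ _ _] _] := first_order Cf Wu; rewrite d1c gE //; move: ke (csin2 Cf Wu) s0.
move: (omega2 _ _ _ u) (ccos _ _ u) (csin _ _ u) => o x y ke E y0 H.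
have : k * (4 * y ^+ 2 - 1) = 0.
  have -> : k * (4 * y ^+ 2 - 1) = 2 * y * (2 * y * k - x * o) + (2 * o * x * y - k) by ring.
  by rewrite -H ke subrr mulr0 addr0.
by move/eqP; rewrite mulf_eq0 (negPf k0) /= => /eqP; move: E; lra.
Qed.

Lemma g_constant_k_neq0 : a = 0 -> k != 0 -> forall p q, g p = g q.
Proof.
move=> a0 k0 p0; have [p pmax] := gmax p0; have [q qmin] := gmin p0.
have pE : 4 * g p ^+ 2 = 3.
  by apply: (extremal_value a0 k0 (oner_neq0 R)) => x; rewrite !mul1r.
have qE : 4 * g q ^+ 2 = 3.
  have N1 : -1 != 0 :> R by rewrite oppr_eq0 oner_neq0.
  by apply: (extremal_value a0 k0 N1) => x; rewrite !mulN1r lerN2.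
apply: (@sqr_constant R M g (3 / 4) cM g_continuous) => {}p0.
by have := pmax p0; have := qmin p0; lra.
Qed.

(** The set where [g ^ 2] is maximal is closed, and open by [ccos_near_max]. *)
Lemma g_constant_k_eq0 : a = 0 -> k = 0 -> forall p q, g p = g q.
Proof.
move=> a0 k0 p0; have [p pmax] := gmax p0.
have [gp0|gp0] := eqVneq (g p) 0.
  apply: (@sqr_constant R M g 0 cM g_continuous) => q.
  by apply/eqP; rewrite eq_le sqr_ge0 andbT; have := pmax q; rewrite gp0 expr0n.
have cg2 : continuous (fun q => g q ^+ 2).
  have -> : (fun p => g p ^+ 2) = (fun p => g p * g p) by apply/funext => q; rewrite expr2.
  by move=> x; apply: cvgM; exact: g_continuous.
pose B := [set q | g q ^+ 2 = g p ^+ 2].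
suff BT : B = [set: M].
  apply: (@sqr_constant R M g (g p ^+ 2) cM g_continuous) => q.
  by have : B q by rewrite BT.
have oB : open B.
  rewrite openE => q Bq; rewrite /interior /=.
  have [phi [u [W [e1 [e2 [[Aphi Wu Wd phiu] [Cf gE]]]]]]] := local q.
  have Fr := contact_orthonormal Cf; rewrite -phiu in Bq *.
  have c0 : ccos (F \o phi) e2 u != 0.
    by rewrite -gE // -sqrf_eq0 Bq sqrf_eq0.
  have qmax x : 1 * g x ^+ 2 <= 1 * g (phi u) ^+ 2 by rewrite !mul1r Bq.
  have [_ d2c] := critical (oner_neq0 _) Aphi Wu Wd Cf gE qmax c0.
  have half := half_of_gauss_ge0 Cf k0 a0 Wu c0 d2c (K_ge0 Aphi (Wd _ Wu)).
  have nW := near_in (frame_open Fr) Wu.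
  have near_le : \forall w \near u, ccos (F \o phi) e2 w ^+ 2 <= ccos (F \o phi) e2 u ^+ 2.
    by apply: filterS nW => w Ww; rewrite -!gE // Bq.
  have := ccos_near_max Cf k0 a0 Wu c0 d2c half near_le => nc.
  apply: (near_chart (P := fun x => g x ^+ 2 = g p ^+ 2) (chartP Aphi) (Wd _ Wu)).
  near=> w; rewrite gE; last by near: w.
  by rewrite -Bq gE //; near: w.
apply: cM; first by exists p.
  by exists B; rewrite ?setTI.
exists B; last by rewrite setTI.
have -> : B = (fun q => g q ^+ 2) @^-1` [set g p ^+ 2] by [].
by apply: closed_comp => // x _; exact: cg2.
Unshelve. all: by end_near.
Qed.

Lemma g_constant p q : g p = g q.
Proof.
have [a0|a0] := eqVneq a 0; last exact: g_constant_a_neq0.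
by have [k0|k0] := eqVneq k 0; [exact: g_constant_k_eq0|exact: g_constant_k_neq0].
Qed.

End global.

Theorem corollary1p2 (R : realType) (M : topologicalType)
    (A : set (param R M)) (F : M -> 'C3[R]) (beta alpha a b : M -> R)
    (surfM : compact_surface A)
    (F_S5 : forall p, S5 (F p))
    (immF : immersion A F)
    (minF : forall phi u, A phi -> dom phi u ->
       mean_curvature (F \o phi) u = 0)
    (betaP : forall p, beta p <> 0 /\ beta p <> pi)
    (alphaP : forall p, alpha p <> 0 /\ alpha p <> pi)
    (dataF : adapted_data A F beta alpha a b)
    (diag_e3 : forall p, b p = 0)
    (alpha_cst : is_constant alpha)
    (a_cst : is_constant a)
    (K_ge0 : forall phi u, A phi -> dom phi u ->
       0 <= gauss_curvature (F \o phi) u) :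
  is_constant beta.
Proof.
have [alpha0 alphaE] := alpha_cst; have [a0 aE] := a_cst.
have ccosE (phi : param R M) e2 w :
    contact_angle ((F \o phi) w) (e2 w) = acos (ccos (F \o phi) e2 w).
  by rewrite /contact_angle inner_ip /reeb mulI_mI.
have local p : exists (phi : param R M) (u : 'rV[R]_2) (W : set 'rV[R]_2)
    (e1 e2 : 'rV[R]_2 -> 'C3[R]),
  [/\ A phi, W u, W `<=` dom phi & phi u = p] /\
  contact_frame (F \o phi) e1 e2 (cos alpha0) (sin alpha0) W a0 /\
  forall w, W w -> beta (phi w) = acos (ccos (F \o phi) e2 w) /\
                   cos (beta (phi w)) = ccos (F \o phi) e2 w.
  have [phi [u [W [e1 [e2 [[Aphi du phiu] [[oW Wu Wd] [ad H]]]]]]]] := dataF p.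
  exists phi, u, W, e1, e2; split; first by split.
  have [sX _] := immF phi Aphi.
  have Cf : contact_frame (F \o phi) e1 e2 (cos alpha0) (sin alpha0) W a0.
    apply: (bridge_contact_frame oW _ ad _ _ _ _ _ _ Wu).
    - move=> j; have [s1 s2] := sX j.
      by split=> s w Ww; [apply: s1|apply: s2]; exact: Wd.
    - by move=> w _; exact: F_S5.
    - by move=> w Ww; apply: minF => //; exact: Wd.
    - by rewrite -(alphaE p); exact: alphaP.
    - by move=> w /H[_ <- _]; rewrite alphaE.
    - by move=> w /H[<- _ _]; exact: betaP.
    - by move=> w i /H[_ _ ->]; rewrite aE diag_e3 mul0r addr0.
  split=> // w Ww; have [bE _ _] := H w Ww; rewrite bE ccosE; split=> //.
  rewrite acosK // in_itv /=; have := contact_lt1 Cf Ww.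
  by rewrite -ler_norml => h; apply: ltW; rewrite -(expr_lt1 (n := 2)) ?normr_ge0 // real_normK ?num_real.
have gc p q : cos (beta p) = cos (beta q).
  apply: (@g_constant R M A F (fun p => cos (beta p)) (cos alpha0) (sin alpha0) a0 surfM K_ge0).
  move=> {}p; have [phi [u [W [e1 [e2 [h1 [h2 h3]]]]]]] := local p.
  by exists phi, u, W, e1, e2; split=> //; split=> // w /h3[].
have bE p : beta p = acos (cos (beta p)).
  have [phi [u [W [e1 [e2 [[_ Wu _ <-] [_ h3]]]]]]] := local p.
  by have [-> E] := h3 u Wu; rewrite -{1}E.
have [[p0]|noM] := pselect (inhabited M).
  by exists (beta p0) => p; rewrite bE (gc p p0) -bE.
by exists 0 => p; case: noM; exists.
Qed.
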